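(* The elements $T_{k_1,l_1}\odot \cdots \odot T_{k_n,l_n}$ form a basis for $\mathcal{T}$. A basis for the subspace $\mathrm{Sym}^\odot(\mathcal{S})$ is given by the subset of elements for which $k_i\geq l_i$ for all $i$.
   Context: $\mathscr{P}$ is the set of partitions and $r_m(\lambda)$ the number of parts of $\lambda$ equal to $m$. The Faulhaber polynomial $F_l$ is the polynomial with zero constant term with $F_l(n)=\sum_{i=1}^n i^{l-1}$ for $n\ge1$. For $k\ge0,l\ge1$, $k+l$ even, $T_{k,l}(\lambda)=-\frac{B_{k+l}}{2(k+l)}(\delta_{l,1}+\delta_{k,0})+\sum_{m\ge1}m^kF_l(r_m(\lambda))$; $S_k=T_{k-1,1}$ for even $k\ge2$. The induced product $\odot$ is defined by $\langle f\odot g\rangle_{\vec u}=\langle f\rangle_{\vec u}\langle g\rangle_{\vec u}$ with $\langle f\rangle_{\vec u}=\sum_\lambda f(\lambda)u_{\lambda_1}u_{\lambda_2}\cdots/\sum_\lambda u_{\lambda_1}u_{\lambda_2}\cdots$. $\mathcal{T}$ is generated by the $T_{k,l}$ under pointwise product; $\mathcal{S}$ is generated by the $S_k$ under pointwise product and $\mathrm{Sym}^\odot(\mathcal{S})$ by the elements of $\mathcal{S}$ under the induced product. Induced products differing only by a reordering of the factors are considered the same element; $n$ ranges over all $n\ge0$ and each pair $(k_i,l_i)$ satisfies $k_i\ge0$, $l_i\ge1$, $k_i+l_i$ even. *)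

(* Defs.v *)
From HB Require Import structures.
From mathcomp Require Import all_boot all_order all_algebra.
Set Implicit Arguments. Unset Strict Implicit. Unset Printing Implicit Defensive.
Import Order.TTheory GRing.Theory Num.Theory.
Local Open Scope ring_scope.

Definition is_part (s : seq nat) : bool := sorted geq s && all (fun x => 0 < x)%N s.

Record ipartition := IPartition { pval : seq nat; pvalP : is_part pval }.
HB.instance Definition _ := [isSub for pval].
HB.instance Definition _ := [Equality of ipartition by <:].

Definition p0 : ipartition := @IPartition [::] isT.

Definition r_ (m : nat) (la : ipartition) : nat := count_mem m (pval la).

(* ---------- Bernoulli numbers: B_0 = 1, sum_{j=0}^{n} C(n+1,j) B_j = 0 (n>=1) ---------- *)
Fixpoint bern_list (n : nat) : seq rat :=
  match n with
  | 0 => [:: 1]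
  | n'.+1 => let s := bern_list n' in
      rcons s (- (\sum_(j < n'.+1) ('C(n'.+2, j))%:R * s`_j) / (n'.+2)%:R)
  end.
Definition bern (n : nat) : rat := nth 0 (bern_list n) n.

(* Faulhaber polynomial F_l evaluated at a natural number r:
   F_l(r) = sum_{i=1}^r i^(l-1)  (F_l(0) = 0 since F_l has zero constant term) *)
Definition faulhaber (l r : nat) : rat := \sum_(1 <= i < r.+1) (i%:R) ^+ l.-1.

Definition T (k l : nat) (la : ipartition) : rat :=
  - bern (k + l) / (2 * (k + l))%:R * ((l == 1%N)%:R + (k == 0%N)%:R)
  + \sum_(1 <= m < (sumn (pval la)).+1) (m%:R) ^+ k * faulhaber l (r_ m la).

Definition S (k : nat) : ipartition -> rat := T k.-1 1.

(* ---------- Formal power series in u_1,u_2,...: coefficient functions on partitions,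
   the coefficient of a ipartition la being the one of u_{la_1} u_{la_2} ... ---------- *)

Definition subparts (la : ipartition) : seq ipartition :=
  undup [seq insubd p0 (mask (val t) (pval la)) | t : (size (pval la)).-tuple bool].
Definition pdiff (la mu : ipartition) : ipartition :=
  insubd p0 (foldl (fun s x => rem x s) (pval la) (pval mu)).

Definition conv (f g : ipartition -> rat) (la : ipartition) : rat :=
  \sum_(mu <- subparts la) f mu * g (pdiff la mu).

(* coefficients of 1/Z = prod_m (1 - u_m), where Z = sum_la u_la = prod_m 1/(1-u_m) *)
Definition zinv (la : ipartition) : rat :=
  if uniq (pval la) then (-1) ^+ size (pval la) else 0.

(* <f>_u = (sum f(la) u_la) / Z  as a formal series *)
Definition ubracket (f : ipartition -> rat) : ipartition -> rat := conv f zinv.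

(* induced product: <f (.) g>_u = <f>_u <g>_u, i.e.
   sum (f(.)g)(la) u_la = (sum f u_la)(sum g u_la) / Z *)
Definition odot (f g : ipartition -> rat) : ipartition -> rat := conv (conv f g) zinv.

Definition one : ipartition -> rat := fun _ => 1.

Definition odot_list (fs : seq (ipartition -> rat)) : ipartition -> rat := foldr odot one fs.

Definition span (P : (ipartition -> rat) -> Prop) (f : ipartition -> rat) : Prop :=
  exists n (g : 'I_n -> ipartition -> rat) (c : 'I_n -> rat),
    (forall i, P (g i)) /\ (forall la, f la = \sum_(i < n) c i * g i la).

Definition prodf (fs : seq (ipartition -> rat)) : ipartition -> rat :=
  fun la => \prod_(g <- fs) g la.

Definition validkl (p : nat * nat) : bool := (0 < p.2)%N && ~~ odd (p.1 + p.2).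

Definition inT (f : ipartition -> rat) : Prop :=
  span (fun g => exists s : seq (nat * nat), all validkl s /\
                   g = prodf [seq T p.1 p.2 | p <- s]) f.

Definition inS (f : ipartition -> rat) : Prop :=
  span (fun g => exists ks : seq nat, all (fun k => (1 < k)%N && ~~ odd k) ks /\
                   g = prodf [seq S k | k <- ks]) f.

Definition inSymS (f : ipartition -> rat) : Prop :=
  span (fun g => exists fs : seq (ipartition -> rat), (forall i, (i < size fs)%N -> inS (nth one fs i)) /\
                   g = odot_list fs) f.

Definition Todot (s : seq (nat * nat)) : ipartition -> rat :=
  odot_list [seq T p.1 p.2 | p <- s].

(* The family { Todot s : ok s } (s taken up to reordering) is a basis of V *)
Definition is_Tbasis (V : (ipartition -> rat) -> Prop) (ok : seq (nat * nat) -> bool) : Prop :=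
  [/\ (forall s, ok s -> V (Todot s)),
      (forall f, V f -> exists n (s : 'I_n -> seq (nat * nat)) (c : 'I_n -> rat),
          (forall i, ok (s i)) /\ (forall la, f la = \sum_(i < n) c i * Todot (s i) la)) &
      (forall n (s : 'I_n -> seq (nat * nat)) (c : 'I_n -> rat),
          (forall i, ok (s i)) ->
          (forall i j, perm_eq (s i) (s j) -> i = j) ->
          (forall la, \sum_(i < n) c i * Todot (s i) la = 0) ->
          forall i, c i = 0)].

(* Main.v *)
(* Functions on partitions form, under convolution, the ring of power series in the u_m, and
   <f>_u = f / Z with Z = sum_la u_la; hence T_(k_1,l_1) (.) ... (.) T_(k_n,l_n) corresponds to
   the product of the series P_(k,l) = const + sum_(m,r >= 1) m^k r^(l-1) u_m^r.

   Independence: on a partition with n distinct parts m_j of multiplicities r_j, a product of n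
   series P_(k_i,l_i) has the coefficient sum_sigma prod_i m_(sigma i)^(k_i) r_(sigma i)^(l_i - 1),
   and shorter products vanish.  For m_j = N^(B^(2j)) and r_j = N^(B^(2j+1)) this is a polynomial
   in N whose exponents determine the multiset of the (k_i, l_i).

   Spanning: pointwise multiplication by sum_m m^k r_m is a derivation mapping P_(k',l') to
   P_(k+k',l'+1) up to a constant, which settles Sym(S).  For general T_(k,l), multiplication by
   (r_m + 1/2)^l becomes, after dividing by Z, the operator (D_m + h_m)^l with D_m = u_m d/du_m
   and h_m = 1/2 + u_m / (1 - u_m).  As D_m h_m = h_m^2 - 1/4, this operator preserves a parity in
   h_m, and so T_(k,l) times (Z w), for w a product of n series P, equals Z P_(k,l) w up to Z times
   products of at most n series P; the two spans then agree by induction on n. *)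
Require Import Defs.
From HB Require Import structures.
From mathcomp Require Import all_boot all_order all_algebra.
From mathcomp Require Import boolp.
From mathcomp Require Import ring lra zify.
Set Implicit Arguments. Unset Strict Implicit. Unset Printing Implicit Defensive.
Import Order.TTheory GRing.Theory Num.Theory.
Local Open Scope ring_scope.

(** * Partitions and the convolution ring *)

Implicit Types (la mu nu : ipartition) (m k l n : nat).

Lemma geq_trans : transitive geq.
Proof. by move=> a b c ab bc; apply: leq_trans bc ab. Qed.

Lemma geq_anti : antisymmetric geq.
Proof. by move=> a b; rewrite andbC => /anti_leq. Qed.

Lemma pval_sorted la : sorted geq (pval la).
Proof. by have /andP[] := pvalP la. Qed.

Lemma pval_pos la : all (fun x => 0 < x)%N (pval la).
Proof. by have /andP[] := pvalP la. Qed.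

Lemma r_0 la : r_ 0 la = 0%N.
Proof. by apply/count_memPn/negP => /(allP (pval_pos la)). Qed.

Lemma r_gt0 m la : (0 < r_ m la)%N = (m \in pval la).
Proof. by rewrite -has_count has_pred1. Qed.

Lemma part_perm_eq la mu : perm_eq (pval la) (pval mu) -> la = mu.
Proof.
move=> e; apply: val_inj; apply: (sorted_eq geq_trans geq_anti) => //;
  exact: pval_sorted.
Qed.

(** Partitions are handled through their multiplicities from here on, so that identities between
    them become arithmetic of natural numbers. *)
Lemma part_ext la mu : (forall m, r_ m la = r_ m mu) -> la = mu.
Proof.
move=> e; apply: part_perm_eq; apply/allP => m _; apply/eqP; exact: e.
Qed.

Definition mkpart (s : seq nat) : ipartition :=
  insubd p0 (sort geq [seq x <- s | 0 < x]%N).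

Lemma pval_mkpart s :
  perm_eq (pval (mkpart s)) [seq x <- s | (0 < x)%N].
Proof.
rewrite [pval _]val_insubd /is_part sort_sorted ?all_sort ?filter_all ?perm_sort //.
Qed.

Lemma r_mkpart m s : (0 < m)%N -> r_ m (mkpart s) = count_mem m s.
Proof.
move=> m0; rewrite /r_ (permP (pval_mkpart s)) count_filter.
by apply: eq_count => x /=; case: eqP => // ->.
Qed.

Definition padd la mu : ipartition := mkpart (pval la ++ pval mu).

Lemma r_padd m la mu : r_ m (padd la mu) = (r_ m la + r_ m mu)%N.
Proof. by case: m => [|m]; rewrite ?r_0 // r_mkpart // count_cat. Qed.

Lemma foldl_rem_subseq (t s : seq nat) :
  subseq (foldl (fun s x => rem x s) s t) s.
Proof.
elim: t s => //= x t IH s; exact: subseq_trans (IH _) (rem_subseq _ _).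
Qed.

(** [rem] of an absent entry changes nothing, just as truncated subtraction stops at 0. *)
Lemma r_pdiff m la mu : r_ m (pdiff la mu) = (r_ m la - r_ m mu)%N.
Proof.
rewrite /r_ /pdiff.
rewrite [pval _]val_insubd.
have sub := foldl_rem_subseq (pval mu) (pval la).
rewrite /is_part (subseq_sorted geq_trans sub (pval_sorted la)) /=.
rewrite (_ : all _ _ = true); last first.
  by apply/allP => x /(mem_subseq sub)/(allP (pval_pos la)).
elim: (pval mu) (pval la) => [|x t IH] s /=; first by rewrite subn0.
rewrite IH count_rem /= subnDA; case: (boolP (x == m)) => [/eqP->|_] /=.
  rewrite andbT; case: (boolP (m \in s)) => // /count_memPn ->; lia.
by rewrite andbF.
Qed.

Lemma subpartsP mu la :
  reflect (forall m, r_ m mu <= r_ m la)%N (mu \in subparts la).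
Proof.
rewrite /subparts mem_undup; apply: (iffP mapP) => [[t _ ->] m|].
  rewrite /r_ [pval (insubd _ _)]val_insubd; case: ifP => // _.
  exact: leq_count_mask.
move=> /count_subseqP[s ss /permP e].
have es : pval mu = s.
  apply: (sorted_eq geq_trans geq_anti (pval_sorted mu)).
    exact: (subseq_sorted geq_trans ss (pval_sorted la)).
  exact/permP.
case/subseqP: ss => t st es'.
have tP : size t == size (pval la) by rewrite st.
exists (Tuple tP); first by rewrite mem_enum.
by apply: val_inj; rewrite val_insubd /= -es' -es [is_part _](pvalP mu).
Qed.

Lemma subparts_uniq la : uniq (subparts la).
Proof. exact: undup_uniq. Qed.

Lemma r_p0 m : r_ m p0 = 0%N. Proof. by []. Qed.

Lemma p0_subparts la : p0 \in subparts la.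
Proof. by apply/subpartsP. Qed.

Lemma pdiff_subparts la mu : pdiff la mu \in subparts la.
Proof. by apply/subpartsP => m; rewrite r_pdiff leq_subr. Qed.

Lemma pdiffp0 la : pdiff la p0 = la.
Proof. by apply: part_ext => m; rewrite r_pdiff subn0. Qed.

Lemma pdiffK la mu : mu \in subparts la -> pdiff la (pdiff la mu) = mu.
Proof.
by move=> /subpartsP h; apply: part_ext => m; rewrite !r_pdiff subKn.
Qed.

Lemma padd_pdiff la mu : mu \in subparts la -> padd mu (pdiff la mu) = la.
Proof.
by move=> /subpartsP h; apply: part_ext => m; rewrite r_padd r_pdiff subnKC.
Qed.

Lemma sumn_subparts la mu : mu \in subparts la ->
  (sumn (pval mu) <= sumn (pval la))%N.
Proof.
move=> /padd_pdiff <-; have /perm_sumn -> := pval_mkpart (pval mu ++ pval (pdiff la mu)).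
rewrite (all_filterP _) ?all_cat ?pval_pos // sumn_cat; exact: leq_addr.
Qed.

Lemma r_sumn m la : (sumn (pval la) < m)%N -> r_ m la = 0%N.
Proof.
move=> h; apply/count_memPn/negP => hm; move: h; rewrite ltnNge => /negP; apply.
by elim: (pval la) hm => //= x s IH; rewrite inE => /orP[/eqP->|/IH]; lia.
Qed.

(** A separate name for the function type, meant to carry convolution as its ring product instead of
    the pointwise one. *)
Definition pser := ipartition -> rat.
HB.instance Definition _ := gen_eqMixin pser.
HB.instance Definition _ := gen_choiceMixin pser.

Implicit Types f g w : pser.

Definition pser_add f g : pser := fun la => f la + g la.
Definition pser_opp f : pser := fun la => - f la.
Definition pser_zero : pser := fun=> 0.
Definition pser_one : pser := fun la => (la == p0)%:R.
Definition pser_scale (c : rat) f : pser := fun la => c * f la.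

Lemma pser_addA : associative pser_add.
Proof. by move=> f g w; apply: funext => la; exact: addrA. Qed.
Lemma pser_addC : commutative pser_add.
Proof. by move=> f g; apply: funext => la; exact: addrC. Qed.
Lemma pser_add0 : left_id pser_zero pser_add.
Proof. by move=> f; apply: funext => la; exact: add0r. Qed.
Lemma pser_addN : left_inverse pser_zero pser_opp pser_add.
Proof. by move=> f; apply: funext => la; exact: addNr. Qed.

HB.instance Definition _ :=
  GRing.isZmodule.Build pser pser_addA pser_addC pser_add0 pser_addN.

(** Taking the complement [pdiff la mu] is an involution on the sub-partitions of [la]. *)
Lemma convC : commutative (conv : pser -> pser -> pser).
Proof.
move=> f g; apply: funext => la; rewrite /conv.
rewrite (perm_big [seq pdiff la mu | mu <- subparts la]) /=; last first.
  apply: uniq_perm; first exact: subparts_uniq.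
    rewrite map_inj_in_uniq ?subparts_uniq // => x y hx hy e.
    by rewrite -(pdiffK hx) e pdiffK.
  move=> x; apply/idP/mapP => [hx|[y _ ->]]; last exact: pdiff_subparts.
  by exists (pdiff la x); rewrite ?pdiff_subparts ?pdiffK.
by rewrite big_map; apply: eq_big_seq => mu hmu; rewrite pdiffK // mulrC.
Qed.

(** Both sides are sums over chains of [nu] inside [mu] inside [la]; the inner sum is reindexed by
    [mu = padd nu rho]. *)
Lemma convA : associative (conv : pser -> pser -> pser).
Proof.
move=> f g w; apply: funext => la; apply: esym; rewrite /conv.
transitivity (\sum_(mu <- subparts la) \sum_(nu <- subparts la | nu \in subparts mu)
   f nu * g (pdiff mu nu) * w (pdiff la mu)).
  apply: eq_big_seq => mu hmu; rewrite mulr_suml -[RHS]big_filter.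
  apply: perm_big; apply: uniq_perm; rewrite ?filter_uniq ?subparts_uniq //.
  move=> x; rewrite mem_filter; case: (boolP (x \in subparts mu)) => //= hx.
  apply/esym/subpartsP => m.
  exact: leq_trans (elimT (subpartsP _ _) hx m) (elimT (subpartsP _ _) hmu m).
rewrite (exchange_big_dep predT) //=; apply: eq_big_seq => nu hnu.
rewrite mulr_sumr -big_filter.
rewrite (perm_big [seq padd nu rho | rho <- subparts (pdiff la nu)]) /=; last first.
  apply: uniq_perm; rewrite ?filter_uniq ?subparts_uniq //.
    rewrite map_inj_in_uniq ?subparts_uniq // => x y _ _ e; apply: part_ext => m.
    by have := congr1 (r_ m) e; rewrite !r_padd; lia.
  move=> x; rewrite mem_filter; apply/andP/mapP => [[/subpartsP h1 /subpartsP h2]|].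
    exists (pdiff x nu); last by rewrite padd_pdiff //; exact/subpartsP.
    by apply/subpartsP => m; rewrite !r_pdiff leq_sub2r.
  move=> [y /subpartsP hy ->]; split; apply/subpartsP => m; rewrite r_padd ?leq_addr //.
  by move: (hy m) (elimT (subpartsP _ _) hnu m); rewrite r_pdiff; lia.
rewrite big_map; apply: eq_big_seq => rho _; rewrite -mulrA; congr (_ * (g _ * w _)).
  by apply: part_ext => m; rewrite r_pdiff r_padd addKn.
by apply: part_ext => m; rewrite !r_pdiff r_padd subnDA.
Qed.

Lemma conv1l : left_id pser_one (conv : pser -> pser -> pser).
Proof.
move=> f; apply: funext => la; rewrite /conv (bigD1_seq p0) ?p0_subparts ?subparts_uniq //=.
rewrite /pser_one eqxx mul1r pdiffp0 big1 ?addr0 // => mu /negbTE ->.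
by rewrite mul0r.
Qed.

Lemma convDl : left_distributive (conv : pser -> pser -> pser) +%R.
Proof.
move=> f g w; apply: funext => la; apply: etrans (big_split _ _ _ _ _).
by apply: eq_bigr => mu _; exact: mulrDl.
Qed.

Lemma pser_one_neq0 : pser_one != 0.
Proof.
apply/eqP => /(congr1 (fun f : pser => f p0)); rewrite /pser_one eqxx.
by move/eqP; rewrite oner_eq0.
Qed.

HB.instance Definition _ := GRing.Zmodule_isComNzRing.Build pser
  convA convC conv1l convDl pser_one_neq0.

Lemma pser_scaleA a b f : pser_scale a (pser_scale b f) = pser_scale (a * b) f.
Proof. by apply: funext => la; exact: mulrA. Qed.
Lemma pser_scale1 : left_id 1 pser_scale.
Proof. by move=> f; apply: funext => la; exact: mul1r. Qed.
Lemma pser_scaleDr : right_distributive pser_scale +%R.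
Proof. by move=> c f g; apply: funext => la; exact: mulrDr. Qed.
Lemma pser_scaleDl f : {morph pser_scale^~ f : a b / a + b}.
Proof. by move=> a b; apply: funext => la; exact: mulrDl. Qed.

HB.instance Definition _ := GRing.Zmodule_isLmodule.Build rat pser
  pser_scaleA pser_scale1 pser_scaleDr pser_scaleDl.

Lemma pser_scaleAl (c : rat) f g : c *: (f * g) = c *: f * g.
Proof.
apply: funext => la; apply: etrans (mulr_sumr _ _ _ _) _.
by apply: eq_bigr => mu _; exact: mulrA.
Qed.

HB.instance Definition _ := GRing.Lmodule_isLalgebra.Build rat pser pser_scaleAl.

Lemma pser_scaleAr (c : rat) f g : c *: (f * g) = f * (c *: g).
Proof. by rewrite mulrC pser_scaleAl mulrC. Qed.

HB.instance Definition _ := GRing.Lalgebra_isAlgebra.Build rat pser pser_scaleAr.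

Lemma pserM f g la : (f * g) la = \sum_(mu <- subparts la) f mu * g (pdiff la mu).
Proof. by []. Qed.
Lemma pserD f g la : (f + g) la = f la + g la. Proof. by []. Qed.
Lemma pserN f la : (- f) la = - f la. Proof. by []. Qed.
Lemma pserZ c f la : (c *: f) la = c * f la. Proof. by []. Qed.
Lemma pser0 la : (0 : pser) la = 0. Proof. by []. Qed.
Lemma pser1 la : (1 : pser) la = (la == p0)%:R. Proof. by []. Qed.

Lemma pser_sum I (r : seq I) (Q : pred I) (F : I -> pser) la :
  (\sum_(i <- r | Q i) F i) la = \sum_(i <- r | Q i) F i la.
Proof. by elim/big_rec2: _ => // i x y _ <-. Qed.

Lemma part_uniqP la : reflect (forall m, r_ m la <= 1)%N (uniq (pval la)).
Proof.
apply: (iffP idP) => [u m|h]; first by rewrite /r_ count_uniq_mem // leq_b1.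
apply/count_mem_uniq => m; have := h m; rewrite -r_gt0 /r_.
by case: (count_mem m _) => [|[]].
Qed.

(** For [la] non-empty, adding or removing one fixed part [m] of [la] is an involution on its
    sub-partitions with distinct parts, and it flips the sign of [zinv]. *)
Lemma mulZzinv : (Defs.one : pser) * (zinv : pser) = 1.
Proof.
rewrite mulrC; apply: funext => la; rewrite pserM pser1.
under eq_bigr do rewrite mulr1.
case: (eqVneq la p0) => [->|la0].
  rewrite (bigD1_seq p0) ?p0_subparts ?subparts_uniq //= big1_seq ?addr0 //.
  move=> mu /andP[/eqP n0 /subpartsP h]; case: n0; apply: part_ext => m.
  by have := h m; rewrite r_p0; lia.
have [m ml] : exists m, m \in pval la.
  case e : (pval la) => [|m s]; last by exists m; rewrite mem_head.
  by case/eqP: la0; apply: val_inj.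
have m0 : (0 < m)%N := allP (pval_pos la) _ ml.
have r1 a : r_ a (mkpart [:: m]) = (m == a) :> nat.
  by case: a => [|a]; rewrite ?r_0 ?r_mkpart //= ?addn0 // (gtn_eqF m0).
rewrite (bigID (fun mu => uniq (pval mu))) /= [X in _ + X]big1 ?addr0; last first.
  by move=> mu /negbTE h; rewrite /zinv h.
rewrite (bigID (fun mu => r_ m mu == 0%N)) /=.
rewrite -[X in _ + X]big_filter.
rewrite [X in _ + X](perm_big [seq padd (mkpart [:: m]) mu |
    mu <- subparts la & uniq (pval mu) && (r_ m mu == 0%N)]) /=; last first.
  apply: uniq_perm; rewrite ?filter_uniq ?subparts_uniq //.
    rewrite map_inj_in_uniq ?filter_uniq ?subparts_uniq // => x y _ _ e.
    by apply: part_ext => a; have := congr1 (r_ a) e; rewrite !r_padd; lia.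
  move=> x; rewrite mem_filter; apply/andP/mapP => [[/andP[/part_uniqP u xm] xl]|].
    have x1 : mkpart [:: m] \in subparts x.
      by apply/subpartsP => a; rewrite r1; case: eqP => // <-; rewrite lt0n.
    exists (pdiff x (mkpart [:: m])); last by rewrite padd_pdiff.
    rewrite mem_filter r_pdiff r1 eqxx -andbA; apply/and3P; split.
    - by apply/part_uniqP => a; rewrite r_pdiff; have := u a; lia.
    - by have := u m; lia.
    - apply/subpartsP => a; rewrite r_pdiff.
      by apply: leq_trans (leq_subr _ _) (elimT (subpartsP _ _) xl a).
  move=> [y]; rewrite mem_filter -andbA => /and3P[/part_uniqP u /eqP ym yl] ->.
  rewrite r_padd r1 eqxx; split; first rewrite andbT.
    apply/part_uniqP => a; rewrite r_padd r1; case: eqP => [<-|_]; first by rewrite ym.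
    exact: u.
  apply/subpartsP => a; rewrite r_padd r1; case: eqP => [<-|_]; rewrite ?ym ?r_gt0 //.
  exact: (elimT (subpartsP _ _) yl).
rewrite big_map big_filter -big_split /= big1 // => mu /andP[u /eqP um].
have pe : perm_eq (pval (padd (mkpart [:: m]) mu)) (m :: pval mu).
  apply/allP => a _; apply/eqP => /=; rewrite -[LHS]/(r_ a _) r_padd r1.
  by rewrite -[count_mem a _]/(r_ a mu).
rewrite /zinv (perm_uniq pe) (perm_size pe) /= u andbT -r_gt0 um /= exprS.
by rewrite mulN1r addrN.
Qed.

(** * The one-variable series [Q] and the generators [P] *)

Local Notation Z := (Defs.one : pser).
Local Notation Zinv := (zinv : pser).

Definition mrect m (r : nat) : ipartition := mkpart (nseq r m).

(** These partitions are the monomials [u_m^r] with [r >= 1]. *)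
Definition rect m la : bool := (0 < r_ m la)%N && (la == mrect m (r_ m la)).

(* The series [\sum_(r >= 1) r^(l-1) u_m^r]. *)
Definition Q l m : pser := fun la => if rect m la then (r_ m la)%:R ^+ l.-1 else 0.

Lemma r_gt0_pos m la : (0 < r_ m la)%N -> (0 < m)%N.
Proof. by case: m => //; rewrite r_0. Qed.

Lemma r_mrect a m r : (0 < m)%N -> r_ a (mrect m r) = ((a == m) * r)%N.
Proof.
case: a => [|a] m0; first by rewrite r_0 (ltn_eqF m0).
by rewrite r_mkpart // count_nseq /= eq_sym.
Qed.

Lemma rect_mrect m r : (0 < m)%N -> (0 < r)%N -> rect m (mrect m r).
Proof. by move=> m0 r0; rewrite /rect r_mrect // eqxx mul1n r0 eqxx. Qed.

Lemma sum_rect m la (G : ipartition -> rat) :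
  \sum_(mu <- subparts la) (if rect m mu then G mu else 0) =
  \sum_(1 <= r < (r_ m la).+1) G (mrect m r).
Proof.
rewrite -big_mkcond -big_filter.
have [m0|m0] := posnP m.
  rewrite m0 r_0 [RHS]big_geq // big1_seq // => mu.
  by rewrite mem_filter /rect r_0.
rewrite (perm_big [seq mrect m r | r <- index_iota 1 (r_ m la).+1]) /=.
  by rewrite big_map.
apply: uniq_perm; rewrite ?filter_uniq ?subparts_uniq //.
  rewrite map_inj_uniq ?iota_uniq // => x y /(congr1 (r_ m)).
  by rewrite !r_mrect // eqxx !mul1n.
move=> mu; rewrite mem_filter; apply/andP/mapP => [[/andP[r0 /eqP e] /subpartsP h]|].
  by exists (r_ m mu) => //; rewrite mem_index_iota r0 ltnS h.
move=> [r]; rewrite mem_index_iota ltnS => /andP[r0 rl] ->; split; first exact: rect_mrect.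
by apply/subpartsP => a; rewrite r_mrect //; case: eqP => [->|]; lia.
Qed.

Lemma mulQ l m f la :
  (Q l m * f) la = \sum_(1 <= r < (r_ m la).+1) r%:R ^+ l.-1 * f (pdiff la (mrect m r)).
Proof.
rewrite pserM.
transitivity (\sum_(mu <- subparts la)
  (if rect m mu then (r_ m mu)%:R ^+ l.-1 * f (pdiff la mu) else 0)).
  by apply: eq_bigr => mu _; rewrite /Q; case: ifP => // _; rewrite mul0r.
rewrite (sum_rect m la (fun mu => (r_ m mu)%:R ^+ l.-1 * f (pdiff la mu))).
apply: eq_big_nat => r /andP[h1 h2].
by rewrite r_mrect ?eqxx ?mul1n //; apply: (@r_gt0_pos m la); lia.
Qed.

(** Multiplication by [Z] takes partial sums in the exponent of [u_m], which turns the coefficients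
    [r^(l-1)] into the values of the Faulhaber polynomial. *)
Lemma mulQZ l m la : (Q l m * Z) la = faulhaber l (r_ m la).
Proof. by rewrite mulQ; apply: eq_bigr => r _; rewrite mulr1. Qed.

(** Stands for the infinite sum over [m >= 1]. Cutting it at the size of [la] loses nothing when
    each [F m] vanishes on partitions without a part [m]; this is the role of [vanishing_off]. *)
Definition msum (F : nat -> pser) : pser :=
  fun la => \sum_(1 <= m < (sumn (pval la)).+1) F m la.

Definition vanishing_off m f := forall la, r_ m la = 0%N -> f la = 0.

Lemma msum_widen F la N : (forall m, vanishing_off m (F m)) ->
  (sumn (pval la) <= N)%N -> msum F la = \sum_(1 <= m < N.+1) F m la.
Proof.
move=> Fv le; rewrite [RHS](big_cat_nat (n := (sumn (pval la)).+1)) //=.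
rewrite [X in _ = _ + X]big1_seq ?addr0 // => m; rewrite mem_index_iota => /andP[_ /andP[h _]].
by rewrite Fv // r_sumn.
Qed.

Lemma msumMl F w : (forall m, vanishing_off m (F m)) ->
  msum F * w = msum (fun m => F m * w).
Proof.
move=> Fv; apply: funext => la; rewrite pserM /msum.
under [RHS]eq_bigr do rewrite pserM.
rewrite exchange_big; apply: eq_big_seq => mu hmu /=.
by rewrite -mulr_suml -(msum_widen Fv (sumn_subparts hmu)).
Qed.

Lemma vanishing_offM m f g : vanishing_off m f -> vanishing_off m (f * g).
Proof.
move=> fv la h; rewrite pserM big1_seq // => mu /andP[_ /subpartsP hmu].
by rewrite fv ?mul0r //; have := hmu m; lia.
Qed.

Lemma vanishing_offZ m c f : vanishing_off m f -> vanishing_off m (c *: f).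
Proof. by move=> fv la h; rewrite pserZ fv ?mulr0. Qed.

Lemma vanishing_off_Q l m : vanishing_off m (Q l m).
Proof. by move=> la h; rewrite /Q /rect h. Qed.

Lemma msumD F G : msum (fun m => F m + G m) = msum F + msum G.
Proof. by apply: funext => la; exact: big_split. Qed.

Lemma msumZ c F : msum (fun m => c *: F m) = c *: msum F.
Proof. by apply: funext => la; rewrite pserZ /msum mulr_sumr. Qed.

Lemma msum0 : msum (fun=> 0) = 0.
Proof. by apply: funext => la; rewrite /msum big1. Qed.

Definition Tconst k l : rat :=
  - bern (k + l) / (2 * (k + l))%:R * ((l == 1%N)%:R + (k == 0%N)%:R).

Definition P k l : pser := (Tconst k l)%:A + msum (fun m => m%:R ^+ k *: Q l m).

Lemma T_eq k l : (T k l : pser) = Z * P k l.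
Proof.
rewrite mulrC mulrDl msumMl; last by move=> m; apply/vanishing_offZ/vanishing_off_Q.
apply: funext => la; rewrite pserD -scalerAl mul1r pserZ mulr1; congr (_ + _).
by apply: eq_bigr => m _; rewrite -scalerAl pserZ mulQZ.
Qed.

Definition PP (s : seq (nat * nat)) : pser := \prod_(p <- s) P p.1 p.2.

Lemma Z_inj f g : Z * f = Z * g -> f = g.
Proof.
by move=> /(congr1 ( *%R Zinv)); rewrite !mulrA [Zinv * _]mulrC mulZzinv !mul1r.
Qed.

Lemma odotE f g : (odot f g : pser) = f * g * Zinv.
Proof. by []. Qed.

Lemma odotZ f g : odot (Z * f) (Z * g) = Z * (f * g) :> pser.
Proof. by rewrite odotE -[RHS]mul1r -mulZzinv; ring. Qed.

Lemma Todot_eq s : (Todot s : pser) = Z * PP s.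
Proof.
elim: s => [|p s IH]; rewrite /PP ?big_nil ?mulr1 // big_cons -odotZ -T_eq -IH.
by [].
Qed.

(** * Pointwise multiplication as an operator on the ring *)

Definition act (phi : ipartition -> rat) f : pser := fun la => phi la * f la.

(** Additivity over splittings of a partition makes [act phi] a derivation for convolution. *)
Definition additive_fun (phi : ipartition -> rat) :=
  forall la mu, mu \in subparts la -> phi mu + phi (pdiff la mu) = phi la.

Lemma actM phi f g : additive_fun phi -> act phi (f * g) = act phi f * g + f * act phi g.
Proof.
move=> pa; apply: funext => la; rewrite pserD !pserM /act mulr_sumr -big_split.
by apply: eq_big_seq => mu /pa <- /=; ring.
Qed.

Lemma actD phi f g : act phi (f + g) = act phi f + act phi g.
Proof. by apply: funext => la; rewrite pserD /act mulrDr. Qed.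

Lemma actZ phi c f : act phi (c *: f) = c *: act phi f.
Proof. by apply: funext => la; rewrite pserZ /act pserZ; ring. Qed.

Lemma actB phi f g : act phi (f - g) = act phi f - act phi g.
Proof. by rewrite -scaleN1r actD actZ scaleN1r. Qed.

Lemma act0 phi : act phi 0 = 0.
Proof. by apply: funext => la; rewrite /act mulr0. Qed.

Lemma act1 phi : phi p0 = 0 -> act phi 1 = 0.
Proof.
by move=> p; apply: funext => la; rewrite /act pser1; case: eqP => [->|_];
  rewrite ?p ?mul0r ?mulr0.
Qed.

Lemma actA phi c : phi p0 = 0 -> act phi c%:A = 0.
Proof. by move=> p; rewrite actZ act1 // scaler0. Qed.

Lemma act_msum phi F : act phi (msum F) = msum (fun m => act phi (F m)).
Proof. by apply: funext => la; rewrite /act /msum mulr_sumr. Qed.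

(** The Euler operator [u_m d/du_m]. *)
Definition rdiff m : pser -> pser := act (fun la => (r_ m la)%:R).

Lemma additive_r m : additive_fun (fun la => (r_ m la)%:R).
Proof. by move=> la mu /subpartsP h; rewrite r_pdiff -natrD subnKC. Qed.

Definition psum k la : rat := \sum_(x <- pval la) x%:R ^+ k.

Lemma psumE k la N : (sumn (pval la) <= N)%N ->
  psum k la = \sum_(1 <= m < N.+1) m%:R ^+ k * (r_ m la)%:R.
Proof.
move=> le; transitivity (\sum_(x <- pval la) \sum_(1 <= m < N.+1) m%:R ^+ k * (x == m)%:R : rat).
  apply: eq_big_seq => x hx; have x0 := allP (pval_pos la) _ hx.
  have xN : (x <= N)%N.
    by rewrite leqNgt; apply/negP => h; move: hx; rewrite -r_gt0 r_sumn //; lia.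
  rewrite (bigD1_seq x) ?iota_uniq ?mem_index_iota ?x0 //= eqxx mulr1 big1 ?addr0 //.
  by move=> m; rewrite eq_sym => /negbTE ->; rewrite mulr0.
rewrite exchange_big; apply: eq_bigr => m _ /=; rewrite -mulr_sumr; congr (_ * _).
by rewrite /r_ -sum1_count natr_sum [RHS]big_mkcond /=; apply: eq_bigr => x _; case: eqP.
Qed.

Lemma additive_psum k : additive_fun (psum k).
Proof.
move=> la mu hmu; rewrite (psumE k (sumn_subparts hmu)) (psumE k (leqnn (sumn (pval la)))).
rewrite (psumE k (sumn_subparts (pdiff_subparts la mu))).
by rewrite -big_split; apply: eq_bigr => m _ /=; rewrite -(additive_r m hmu); ring.
Qed.

Lemma psum_p0 k : psum k p0 = 0.
Proof. by rewrite /psum big_nil. Qed.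

Lemma T1E k la : T k 1 la = Tconst k 1 + psum k la.
Proof.
rewrite /T (psumE k (leqnn _)); congr (_ + _); apply: eq_bigr => m _; congr (_ * _).
rewrite /faulhaber; under eq_bigr do rewrite expr0.
by rewrite sumr_const_nat subSS subn0.
Qed.

Lemma rdiff_Q m m' l : (0 < l)%N ->
  rdiff m (Q l m') = if m == m' then Q l.+1 m else 0.
Proof.
move=> l0; apply: funext => la; rewrite /rdiff /act /Q; case: (eqVneq m m') => [<-|ne].
  by case: ifP => _; rewrite ?mulr0 //= -exprS prednK.
case: ifP => [/andP[r0 /eqP ->]|]; last by rewrite mulr0.
by rewrite r_mrect ?(r_gt0_pos r0) // (negbTE ne) mul0r.
Qed.

Lemma psum_Q k m l : (0 < l)%N -> act (psum k) (Q l m) = m%:R ^+ k *: Q l.+1 m.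
Proof.
move=> l0; apply: funext => la; rewrite pserZ /act /Q.
case: ifP => [/andP[r0 /eqP e]|]; last by rewrite !mulr0.
have m0 := r_gt0_pos r0; rewrite {1}e (psumE k (leqnn _)).
rewrite -[in RHS](prednK l0) exprS mulrA; congr (_ * _).
rewrite (bigD1_seq m) ?iota_uniq //=; last first.
  rewrite mem_index_iota m0 ltnS leqNgt; apply/negP => h.
  by move: (r_sumn h); rewrite r_mrect // eqxx; lia.
rewrite r_mrect // eqxx mul1n big1 ?addr0 // => a ne.
by rewrite r_mrect // (negbTE ne) mulr0.
Qed.

Lemma rdiff_P m k l : (0 < l)%N -> rdiff m (P k l) = m%:R ^+ k *: Q l.+1 m.
Proof.
move=> l0; rewrite /rdiff actD actA ?r_p0 // add0r act_msum.
apply: funext => la; rewrite /msum.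
under eq_bigr do rewrite actZ [act _ _](rdiff_Q _ _ l0).
case: (boolP (m \in index_iota 1 (sumn (pval la)).+1)) => hm.
  rewrite (bigD1_seq m) ?iota_uniq //= eqxx big1 ?addr0 // => a.
  by rewrite eq_sym => /negbTE ->; rewrite scaler0.
rewrite big1_seq => [|a /andP[_ ha]].
  rewrite pserZ vanishing_off_Q ?mulr0 //.
  case: (posnP m) => [->|m0]; first exact: r_0.
  by apply: r_sumn; move: hm; rewrite mem_index_iota m0 ltnS -ltnNge.
by case: eqP => [e|]; [rewrite e ha in hm | rewrite scaler0].
Qed.

Lemma psum_P k' k l : (0 < l)%N ->
  act (psum k') (P k l) = msum (fun m => m%:R ^+ (k' + k) *: Q l.+1 m).
Proof.
move=> l0; rewrite actD actA ?psum_p0 // add0r act_msum; congr msum; apply: funext => m.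
by rewrite actZ psum_Q // scalerA exprD mulrC.
Qed.

(** [T k 1] is a constant plus the additive function [psum k], so the Leibniz rule applies to
    [Z * w]; its value on [Z] itself is read off from [T_eq]. *)
Lemma T1_mul k w : act (T k 1) (Z * w) =
  Z * (P k 1 * w + act (psum k) w).
Proof.
have e f : act (T k 1) f = Tconst k 1 *: f + act (psum k) f.
  by apply: funext => la; rewrite /act T1E pserD pserZ; ring.
rewrite e actM; last exact: additive_psum.
have -> : act (psum k) Z = Z * P k 1 - Tconst k 1 *: Z.
  rewrite -T_eq -[T k 1 : pser](_ : act (T k 1) Z = _).
    by rewrite e addrC addKr.
  by apply: funext => la; rewrite /act mulr1.
by move: (P k 1) => p; rewrite mulrBl mulrDr mulrA -scalerAl; ring.
Qed.

(** * Linear independence *)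

Definition ndist la : nat := size (undup (pval la)).

Lemma mem_pval_pdiff_mrect a m r la : (0 < m)%N ->
  (a \in pval (pdiff la (mrect m r))) = (a \in pval la) && ((a != m) || (r < r_ m la)%N).
Proof.
move=> m0; rewrite -!r_gt0 r_pdiff r_mrect //; case: eqP => [->|_] /=; last by rewrite subn0 andbT.
by rewrite mul1n subn_gt0; case: ltnP => h; rewrite ?andbF // (leq_ltn_trans _ h).
Qed.

Lemma ndist_pdiff_lt m r la : (0 < m)%N -> (r < r_ m la)%N ->
  ndist (pdiff la (mrect m r)) = ndist la.
Proof.
move=> m0 h; apply/perm_size/uniq_perm; rewrite ?undup_uniq // => a.
by rewrite !mem_undup mem_pval_pdiff_mrect // h orbT andbT.
Qed.

Lemma ndist_pdiff_full m la : m \in pval la ->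
  (ndist (pdiff la (mrect m (r_ m la)))).+1 = ndist la.
Proof.
move=> hm; have m0 := allP (pval_pos la) _ hm.
rewrite /ndist [RHS](perm_size (perm_to_rem (x := m) _)) ?mem_undup //=; congr _.+1.
apply/perm_size/uniq_perm; rewrite ?rem_uniq ?undup_uniq // => a.
rewrite mem_rem_uniq ?undup_uniq // inE !mem_undup mem_pval_pdiff_mrect //= ltnn orbF.
by rewrite andbC.
Qed.

(** The constant term of [P k l] leaves all of [la] to [f], and removing only some copies of [m]
    keeps the number of distinct parts. Both contributions are killed by the hypothesis, so only the
    removal of all copies of one part survives. *)
Lemma mulP_coef k l f la :
    (forall mu, (ndist la <= ndist mu)%N -> f mu = 0) ->
  (P k l * f) la = \sum_(m <- undup (pval la))
     m%:R ^+ k * (r_ m la)%:R ^+ l.-1 * f (pdiff la (mrect m (r_ m la))).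
Proof.
move=> fv; rewrite mulrDl msumMl; last by move=> m; apply/vanishing_offZ/vanishing_off_Q.
rewrite pserD -scalerAl mul1r pserZ fv // mulr0 add0r /msum.
rewrite (bigID (fun m => m \in pval la)) /= [X in _ + X]big1 ?addr0; last first.
  by move=> m; rewrite -r_gt0 -eqn0Ngt -scalerAl pserZ mulQ => /eqP->; rewrite big_geq ?mulr0.
rewrite -big_filter (perm_big (undup (pval la))) /=; last first.
  apply: uniq_perm; rewrite ?filter_uniq ?iota_uniq ?undup_uniq // => m.
  rewrite mem_filter mem_undup mem_index_iota; case: (boolP (m \in pval la)) => //= hm.
  rewrite (allP (pval_pos la) _ hm) ltnS leqNgt; apply/negP => /r_sumn h.
  by move: hm; rewrite -r_gt0 h.
apply: eq_big_seq => m; rewrite mem_undup => hm; have m0 := allP (pval_pos la) _ hm.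
rewrite -scalerAl pserZ mulQ -mulrA; congr (_ * _).
rewrite big_nat_recr /=; last by rewrite r_gt0.
rewrite big1_seq ?add0r // => r; rewrite mem_index_iota => /andP[_ /andP[_ h]].
by rewrite fv ?mulr0 // ndist_pdiff_lt.
Qed.

(** Each factor can use up at most one distinct part. *)
Lemma PP_vanish s la : (size s < ndist la)%N -> PP s la = 0.
Proof.
elim: s la => [|p s IH] la /=; rewrite /PP ?big_nil ?big_cons => h.
  by rewrite pser1; case: eqP h => [->|].
rewrite -/(PP s) mulP_coef => [|mu hmu]; last by apply: IH; lia.
rewrite big1_seq // => m /andP[_]; rewrite mem_undup => hm.
by rewrite IH ?mulr0 //; have := ndist_pdiff_full hm; lia.
Qed.

Definition dot (e p : nat * nat) : nat := (e.1 * p.1 + e.2 * p.2.-1)%N.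

(* The exponents [\sum_j dot e_j s_(t j)], one for each bijection [t] between [es] and [s]. *)
Fixpoint pexps (s es : seq (nat * nat)) : seq nat :=
  match s with
  | [::] => if es is [::] then [:: 0%N] else [::]
  | p :: s' => flatten [seq [seq (dot e p + x)%N | x <- pexps s' (rem e es)] | e <- es]
  end.

(** A bijection between [es] and the factors is recorded as a list of matched pairs, here and in the
    converse [pexpsP]. *)
Lemma mem_pexps z es : perm_eq (unzip1 z) es ->
  (\sum_(x <- z) dot x.1 x.2)%N \in pexps (unzip2 z) es.
Proof.
elim: z es => [|[e p] z IH] es /=; first by move=> /perm_size/esym/size0nil ->; rewrite big_nil.
move=> h; have he : e \in es by rewrite -(perm_mem h) mem_head.
apply/flatten_mapP; exists e => //; rewrite big_cons; apply: map_f; apply: IH.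
by rewrite -(perm_cons e); apply: perm_trans h _; exact: perm_to_rem.
Qed.

Lemma pexpsP E s es : E \in pexps s es ->
  exists2 z, perm_eq (unzip1 z) es /\ unzip2 z = s & E = (\sum_(x <- z) dot x.1 x.2)%N.
Proof.
elim: s es E => [|p s IH] es E /=.
  by case: es => // /[1!inE]/eqP ->; exists [::]; rewrite ?big_nil.
move=> /flatten_mapP[e he /mapP[x /IH[z [z1 z2] ->] ->]].
exists ((e, p) :: z); last by rewrite big_cons.
rewrite /= z2; split=> //; apply: perm_trans (_ : perm_eq (e :: rem e es) es).
  by rewrite perm_cons.
by rewrite perm_sym perm_to_rem.
Qed.

(** With part size [N^e.1] and multiplicity [N^e.2], the factor [m^k r^(l-1)] becomes [N] to the
    power [dot e (k, l)]. *)
Definition gridpart (N : nat) (es : seq (nat * nat)) : ipartition :=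
  mkpart (flatten [seq nseq (N ^ e.2) (N ^ e.1)%N | e <- es]).

Section Grid.
Variable N : nat.
Hypothesis N1 : (1 < N)%N.

Lemma r_gridpart m es : (0 < m)%N ->
  r_ m (gridpart N es) = (\sum_(e <- es) (N ^ e.1 == m)%N * N ^ e.2)%N.
Proof.
move=> m0; rewrite r_mkpart // count_flatten sumnE !big_map.
by apply: eq_bigr => e _; rewrite count_nseq.
Qed.

Lemma r_gridpart_mem e es : uniq (unzip1 es) -> e \in es ->
  r_ (N ^ e.1)%N (gridpart N es) = (N ^ e.2)%N.
Proof.
move=> u he; rewrite r_gridpart; last by rewrite expn_gt0 (ltnW N1).
have pe := perm_to_rem he; rewrite (perm_big _ pe) big_cons eqxx mul1n.
move: u; rewrite (perm_uniq (perm_map fst pe)) /= => /andP[nin _].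
rewrite big1_seq ?addn0 // => x /andP[_ hx]; rewrite eqn_exp2l //.
by case: eqP => // xe; case/negP: nin; rewrite -xe; exact: map_f.
Qed.

Lemma mem_gridpart m es : (m \in pval (gridpart N es)) = (m \in [seq N ^ e.1 | e <- es]%N).
Proof.
have [->|m0] := posnP m.
  rewrite -r_gt0 r_0; apply/esym/negP => /mapP[e _ /esym/eqP].
  by rewrite expn_eq0; case: N N1.
rewrite -r_gt0 r_gridpart // lt0n sum_nat_seq_eq0 -has_predC.
apply/hasP/mapP => [[e he]|[e he ->]].
  by rewrite /= muln_eq0 negb_or eqb0 negbK => /andP[/eqP <- _]; exists e.
by exists e; rewrite //= eqxx mul1n -lt0n expn_gt0 (ltnW N1).
Qed.

Lemma undup_gridpart es : uniq (unzip1 es) ->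
  perm_eq (undup (pval (gridpart N es))) [seq N ^ e.1 | e <- es]%N.
Proof.
move=> u; apply: uniq_perm; rewrite ?undup_uniq //.
  rewrite (map_comp (expn N) fst) map_inj_uniq // => x y /eqP.
  by rewrite eqn_exp2l // => /eqP.
by move=> m; rewrite mem_undup mem_gridpart.
Qed.

Lemma ndist_gridpart es : uniq (unzip1 es) -> ndist (gridpart N es) = size es.
Proof. by move=> /undup_gridpart/perm_size; rewrite size_map. Qed.

Lemma pdiff_gridpart e es : uniq (unzip1 es) -> e \in es ->
  pdiff (gridpart N es) (mrect (N ^ e.1)%N (N ^ e.2)%N) = gridpart N (rem e es).
Proof.
move=> u he; apply: part_ext => m; case: (posnP m) => [->|m0]; first by rewrite !r_0.
rewrite r_pdiff r_mrect ?expn_gt0 ?(ltnW N1) // !r_gridpart // [in LHS](big_rem e) //=.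
by rewrite eq_sym addKn.
Qed.

(** Iterating [mulP_coef] removes one distinct part per factor. If there are fewer factors than
    parts, the coefficient is 0 and [pexps] is empty. *)
Lemma PP_gridpart s es : uniq (unzip1 es) -> (size s <= size es)%N ->
  PP s (gridpart N es) = \sum_(E <- pexps s es) N%:R ^+ E.
Proof.
elim: s es => [|p s IH] es u /=.
  case: es u => [|e es] u _; last first.
    by rewrite PP_vanish ?big_nil // ndist_gridpart.
  rewrite /PP big_nil big_seq1 expr0 pser1 (_ : gridpart N [::] = p0) ?eqxx //.
  by apply: part_ext => -[|m]; rewrite ?r_0 // r_gridpart // big_nil.
move=> h; rewrite /PP big_cons -/(PP s) mulP_coef; last first.
  by move=> mu; rewrite ndist_gridpart // => h'; apply: PP_vanish; exact: leq_trans h h'.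
rewrite (perm_big _ (undup_gridpart u)) big_map big_flatten big_map /=.
apply: eq_big_seq => e he; rewrite r_gridpart_mem // pdiff_gridpart // big_map IH.
- rewrite mulr_sumr; apply: eq_bigr => x _.
  by rewrite !natrX -!exprM -!exprD.
- by rewrite (subseq_uniq _ u) // map_subseq // rem_subseq.
- by rewrite size_rem // -ltnS prednK // (leq_ltn_trans _ h).
Qed.

End Grid.

Section Digits.
Variable B : nat.
Hypothesis B1 : (1 < B)%N.

(** The weights are [d] times successive powers of [B], so a weighted sum of the numbers [k_i] and
    [l_i - 1] is [d] times a number with these as its base-[B] digits. *)
Fixpoint weights (d n : nat) : seq (nat * nat) :=
  if n is n'.+1 then (d, B * d)%N :: weights (B * (B * d)) n' else [::].

Lemma size_weights d n : size (weights d n) = n.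
Proof. by elim: n d => //= n IH d; rewrite IH. Qed.

Lemma weights_ge d n x : x \in unzip1 (weights d n) -> (d <= x)%N.
Proof.
elim: n d => //= n IH d; rewrite inE => /orP[/eqP-> //|/IH].
by apply: leq_trans; rewrite mulnA leq_pmull // muln_gt0 (ltnW B1).
Qed.

Lemma weights_uniq d n : (0 < d)%N -> uniq (unzip1 (weights d n)).
Proof.
elim: n d => //= n IH d d0; rewrite IH ?muln_gt0 ?d0 ?(ltnW B1) // andbT.
apply/negP => /weights_ge; rewrite mulnA -[X in (_ <= X)%N -> _]mul1n leq_pmul2r //.
by rewrite leqNgt (leq_trans B1) // leq_pmull // ltnW.
Qed.

Fixpoint horner_digits (t : seq (nat * nat)) : nat :=
  if t is p :: t' then (p.1 + B * (p.2.-1 + B * horner_digits t'))%N else 0%N.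

Lemma sum_dot_weights z d n : unzip1 z = weights d n ->
  (\sum_(x <- z) dot x.1 x.2 = d * horner_digits (unzip2 z))%N.
Proof.
elim: z d n => [|[e p] z IH] d [|n] //=; first by rewrite big_nil muln0.
by case=> -> h; rewrite big_cons (IH _ _ h) /dot /=; lia.
Qed.

(** Digits are recovered by division with remainder by [B]; positivity of [p.2] recovers it from the
    digit [p.2.-1]. *)
Lemma horner_digits_inj t1 t2 : size t1 = size t2 ->
  all (fun p => [&& p.1 < B, 0 < p.2 & p.2 < B])%N (t1 ++ t2) ->
  horner_digits t1 = horner_digits t2 -> t1 = t2.
Proof.
have dm a b x y : (a < B -> b < B -> a + B * x = b + B * y -> a = b /\ x = y)%N.
  move=> ha hb h; have e : a = b.
    by have := congr1 (modn^~ B) h; rewrite /= ![(B * _)%N]mulnC ![(_ + _ * B)%N]addnC !modnMDl !modn_small.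
  by split=> //; move: h; rewrite e => /addnI/eqP; rewrite eqn_pmul2l ?(ltnW B1) // => /eqP.
elim: t1 t2 => [|[a b] t1 IH] [|[a' b'] t2] //= [e]; rewrite all_cat /=.
case/and3P=> /and3P[h1 h2 h3] h4 /andP[/and3P[h5 h6 h7] h8].
case/dm=> // -> /dm[||bd /IH ->] //; try lia.
  by congr ((_, _) :: _); lia.
by rewrite all_cat h4.
Qed.

End Digits.

Lemma perm_map_lift (A C : eqType) (h : A -> C) (z : seq A) (es : seq C) :
  perm_eq (map h z) es -> exists2 z', perm_eq z' z & map h z' = es.
Proof.
elim: es z => [|e es IH] z; first by move=> /perm_size; rewrite size_map => /size0nil ->; exists [::].
move=> pe; have /mapP[x xz ex] : e \in map h z by rewrite (perm_mem pe) mem_head.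
have [|z' z1 z2] := IH (rem x z).
  rewrite -(perm_cons e) -(permPr pe) [X in X :: _]ex -map_cons perm_map //.
  by rewrite perm_sym perm_to_rem.
exists (x :: z'); last by rewrite /= z2 -ex.
by rewrite (permPr (perm_to_rem xz)) perm_cons.
Qed.

(** Otherwise the integers from 2 on would supply as many distinct roots as the size of [p]. *)
Lemma poly_eq0_nat (p : {poly rat}) : (forall N : nat, (1 < N)%N -> p.[N%:R] = 0) -> p = 0.
Proof.
move=> h; apply/eqP; apply: contraT => p0.
have := max_poly_roots p0 (rs := [seq i.+2%:R | i <- iota 0 (size p)]).
rewrite size_map size_iota ltnn; apply; last first.
  by rewrite map_inj_uniq ?iota_uniq // => x y /eqP; rewrite eqr_nat => /eqP[].
by apply/allP => _ /mapP[i _ ->]; apply/eqP/h.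
Qed.

(** Evaluating a relation on the partitions [gridpart N es] gives a polynomial in [N] that vanishes
    for all [N > 1]. One of its exponents comes from a single index [i], which forces [c i = 0]. *)
Lemma PP_free n (s : 'I_n -> seq (nat * nat)) (c : 'I_n -> rat) :
  (forall i, all validkl (s i)) -> (forall i j, perm_eq (s i) (s j) -> i = j) ->
  \sum_(i < n) c i *: PP (s i) = 0 -> forall i, c i = 0.
Proof.
move=> sv sinj c0 i0; apply/eqP; apply: contraT => ci0.
(* A longest [s i] with non-zero coefficient: the products that matter then have no more factors
   than the test partition has distinct parts. *)
have [i ci imax] := (@arg_maxnP _ i0 (fun i => c i != 0) (fun i => size (s i)) ci0).
(* A base larger than every [k] and [l] that occurs; the [.+2] also ensures [1 < B]. *)
pose B := (\max_(j < n) \max_(p <- s j) maxn p.1 p.2).+2.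
have sB j : all (fun p => [&& p.1 < B, 0 < p.2 & p.2 < B])%N (s j).
  apply/allP => p hp; have /andP[-> _] := allP (sv j) _ hp.
  have : (maxn p.1 p.2 <= \max_(j < n) \max_(p <- s j) maxn p.1 p.2)%N.
    apply: leq_trans (leq_bigmax (F := fun j => \max_(p <- s j) maxn p.1 p.2) j).
    by rewrite (big_rem p) //= leq_maxl.
  by rewrite geq_max => /andP[h1 h2]; rewrite /B !(leq_ltn_trans _ (ltnSn _.+1)) // leqW.
have B1 : (1 < B)%N by [].
pose es := weights B 1 (size (s i)).
have ues : uniq (unzip1 es) by exact: weights_uniq.
pose q : {poly rat} := \sum_(j < n) c j *: \sum_(E <- pexps (s j) es) 'X^E.
have q0 : q = 0.
  apply: poly_eq0_nat => N N1; rewrite horner_sum.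
  transitivity ((\sum_(j < n) c j *: PP (s j)) (gridpart N es)); last by rewrite c0.
  rewrite pser_sum; apply: eq_bigr => j _; rewrite hornerZ pserZ horner_sum.
  have [->|cj] := eqVneq (c j) 0; first by rewrite !mul0r.
  rewrite PP_gridpart //; last by rewrite size_weights; exact: imax.
  by congr (_ * _); apply: eq_bigr => E _; rewrite hornerXn.
(* The exponent of the identity matching between the weights and [s i]. *)
pose E0 := (\sum_(x <- zip es (s i)) dot x.1 x.2)%N.
have szs : size es = size (s i) by rewrite size_weights.
have u1 : unzip1 (zip es (s i)) = es by rewrite unzip1_zip ?szs.
have u2 : unzip2 (zip es (s i)) = s i by rewrite unzip2_zip ?szs.
have E0i : E0 \in pexps (s i) es by rewrite -{1}u2; apply: mem_pexps; rewrite u1.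
have E0j j : E0 \in pexps (s j) es -> j = i.
  move=> /pexpsP[z [z1 z2] zE]; apply: sinj.
  (* Reorder the matched pairs so that the weights appear in their original order; the second
     components can then be compared digit by digit. *)
  have [z' zz' z'1] := perm_map_lift z1.
  rewrite -z2 -(permPl (perm_map snd zz' : perm_eq (unzip2 z') (unzip2 z))).
  suff -> : unzip2 z' = s i by [].
  have szz : size z' = size (s i) by rewrite -szs -z'1 size_map.
  apply: (horner_digits_inj B1); first by rewrite size_map.
    by rewrite all_cat sB andbT (perm_all _ (perm_map snd zz' : perm_eq (unzip2 z') (unzip2 z))) z2 sB.
  have := sum_dot_weights B1 z'1; have := sum_dot_weights B1 u1; rewrite !mul1n u2 => <- <-.
  by rewrite (perm_big _ zz') -zE.
(* The coefficient of [q] at [E0] is [c i] times the number of matchings with this exponent, which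
   is positive. *)
have := congr1 (fun r : {poly rat} => r`_E0) q0; rewrite coef0 coef_sum.
have cf j : (c j *: \sum_(E <- pexps (s j) es) 'X^E : {poly rat})`_E0 =
    c j * (count_mem E0 (pexps (s j) es))%:R.
  rewrite coefZ coef_sum -sum1_count natr_sum [in RHS]big_mkcond /=; congr (_ * _).
  by apply: eq_bigr => E _; rewrite coefXn eq_sym; case: eqP.
rewrite (bigD1 i) //= cf big1 ?addr0 => [/eqP|j ne].
  rewrite mulf_eq0 (negbTE ci) /= pnatr_eq0 => /eqP/count_memPn.
  by rewrite E0i.
by rewrite cf (count_memPn _) ?mulr0 //; apply: contra ne => /E0j ->.
Qed.

(** * Spanning by symmetric power sums *)

Local Notation span := (Defs.span : (pser -> Prop) -> pser -> Prop).

Lemma span_gen (G : pser -> Prop) f : G f -> span G f.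
Proof.
by move=> Gf; exists 1%N, (fun=> f), (fun=> 1); split=> // la; rewrite big_ord1 mul1r.
Qed.

Lemma span0 (G : pser -> Prop) : span G 0.
Proof.
by exists 0%N, (fun=> (0 : pser)), (fun=> 0); split=> [[]|la] //; rewrite big_ord0.
Qed.

Lemma spanD (G : pser -> Prop) f g : span G f -> span G g -> span G (f + g).
Proof.
move=> [n1 [g1 [c1 [G1 e1]]]] [n2 [g2 [c2 [G2 e2]]]].
exists (n1 + n2)%N, (fun i => match split i with inl j => g1 j | inr j => g2 j end).
exists (fun i => match split i with inl j => c1 j | inr j => c2 j end).
split=> [i|la]; first by case: (split i).
rewrite pserD e1 e2 big_split_ord /=; congr (_ + _); apply: eq_bigr => i _.
  by rewrite (unsplitK (inl _ i)).
by rewrite (unsplitK (inr _ i)).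
Qed.

Lemma spanZ (G : pser -> Prop) c f : span G f -> span G (c *: f).
Proof.
move=> [n [g [d [Gg e]]]]; exists n, g, (fun i => c * d i); split=> // la.
by rewrite pserZ e mulr_sumr; apply: eq_bigr => i _; rewrite mulrA.
Qed.

Lemma spanB (G : pser -> Prop) f g : span G f -> span G g -> span G (f - g).
Proof. by move=> Gf Gg; rewrite -scaleN1r; apply: spanD => //; apply: spanZ. Qed.

Lemma span_min (G V : pser -> Prop) f :
    V 0 -> (forall x y, V x -> V y -> V (x + y)) -> (forall c x, V x -> V (c *: x)) ->
    (forall x, G x -> V x) -> span G f -> V f.
Proof.
move=> V0 VD VZ VG [n [g [c [Gg e]]]].
have -> : f = \sum_(i < n) c i *: (g i : pser).
  by apply: funext => la; rewrite pser_sum e; apply: eq_bigr.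
by elim/big_ind: _ => // i _; apply/VZ/VG.
Qed.

Lemma span_lin (G H : pser -> Prop) (h : pser -> pser) f :
    h 0 = 0 -> {morph h : x y / x + y} -> (forall c, {morph h : x / c *: x}) ->
    (forall x, G x -> span H (h x)) -> span G f -> span H (h f).
Proof.
move=> h0 hD hZ GH; apply: (span_min (V := fun f => span H (h f))) => //.
- by rewrite h0; exact: span0.
- by move=> x y hx hy; rewrite hD; exact: spanD.
- by move=> c x hx; rewrite hZ; exact: spanZ.
Qed.

Lemma span_mull (G H : pser -> Prop) w f :
  (forall x, G x -> span H (w * x)) -> span G f -> span H (w * f).
Proof.
apply: span_lin; [exact: mulr0 | exact: mulrDr | by move=> c x; rewrite scalerAr].
Qed.

Lemma span_mulr (G H : pser -> Prop) w f :
  (forall x, G x -> span H (x * w)) -> span G f -> span H (f * w).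
Proof. by rewrite mulrC => GH; apply: span_mull => x; rewrite mulrC; apply: GH. Qed.

Lemma span_act (G H : pser -> Prop) phi f :
  (forall x, G x -> span H (act phi x)) -> span G f -> span H (act phi f).
Proof.
by apply: span_lin; [exact: act0 | exact: actD | move=> c x; exact: actZ].
Qed.

(** * Spans of products of the series [P] *)

Definition PPspan (D : pred (seq (nat * nat))) : pser -> Prop :=
  span (fun x => exists2 s, D s & x = PP s).

Lemma PPspan_PP (D : pred (seq (nat * nat))) s : D s -> PPspan D (PP s).
Proof. by move=> Ds; apply: span_gen; exists s. Qed.

Lemma PPspanS (D D' : pred (seq (nat * nat))) f :
  {subset D <= D'} -> PPspan D f -> PPspan D' f.
Proof.
move=> DD; apply: span_min; [exact: span0 | by apply: spanD | by move=> c x; apply: spanZ |].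
by move=> _ [s Ds ->]; apply/PPspan_PP/DD.
Qed.

Lemma PP_cat s1 s2 : PP (s1 ++ s2) = PP s1 * PP s2.
Proof. exact: big_cat. Qed.

Lemma PP_nil : PP [::] = 1.
Proof. exact: big_nil. Qed.

Lemma PP_cons p s : PP (p :: s) = P p.1 p.2 * PP s.
Proof. exact: big_cons. Qed.

Lemma PP_seq1 p : PP [:: p] = P p.1 p.2.
Proof. exact: big_seq1. Qed.

Lemma PPspanM (ok : pred (nat * nat)) f g : PPspan (all ok) f -> PPspan (all ok) g -> PPspan (all ok) (f * g).
Proof.
move=> hf hg; apply: span_mulr hf => _ [s hs ->]; apply: span_mull hg => _ [t ht ->].
by rewrite -PP_cat; apply: PPspan_PP; rewrite all_cat hs.
Qed.

Lemma ZinvZ f : Zinv * (Z * f) = f.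
Proof. by rewrite mulrA [Zinv * _]mulrC mulZzinv mul1r. Qed.

Lemma ZZinv f : Z * (Zinv * f) = f.
Proof. by rewrite mulrA mulZzinv mul1r. Qed.

(** Independence comes from [PP_free] and the cancellation of [Z], so each half of the theorem
    reduces to identifying the space, divided by [Z], with a span of products [PP s]. *)
Lemma is_Tbasis_PPspan (V : pser -> Prop) (ok : pred (nat * nat)) : (forall p, ok p -> validkl p) ->
  (forall f, V f <-> PPspan (all ok) (Zinv * f)) -> is_Tbasis V (all ok).
Proof.
move=> okv VP; split.
- by move=> s hs; apply/VP; rewrite Todot_eq ZinvZ; exact: PPspan_PP.
- move=> f /VP[n [g [c [gP e]]]].
  have /choice[s sP] i : exists t, all ok t /\ g i = PP t by have [t] := gP i; exists t.
  exists n, s, c; split=> [i|la]; first by have [] := sP i.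
  have {e} e : Zinv * f = \sum_(i < n) c i *: (g i : pser).
    by apply: funext => nu; rewrite pser_sum e; apply: eq_bigr.
  rewrite -[f in LHS]ZZinv e mulr_sumr pser_sum; apply: eq_bigr => i _.
  by have [_ ->] := sP i; rewrite -scalerAr pserZ -Todot_eq.
- move=> n s c sok sinj c0; apply: (@PP_free n s) => // [i|].
    by apply: sub_all (sok i); exact: okv.
  apply: Z_inj; rewrite mulr0 mulr_sumr; apply: funext => la; rewrite pser_sum pser0.
  by apply: etrans (c0 la); apply: eq_bigr => i _; rewrite -scalerAr pserZ Todot_eq.
Qed.

(** * The symmetric algebra over the products of the [S_k] *)

Definition okS (p : nat * nat) : bool := validkl p && (p.2 <= p.1)%N.

Lemma msumP k l : msum (fun m => m%:R ^+ k *: Q l m) = P k l - (Tconst k l)%:A.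
Proof. by rewrite /P addrC addKr. Qed.

(** By the Leibniz rule one factor [(k', l')] is replaced by [(k + k', l' + 1)], up to a constant.
    An odd [k] keeps the sum of the indices even and, being at least 1, keeps the first index at
    least as large as the second. *)
Lemma PPspan_act_psum k s : odd k -> all okS s ->
  PPspan (all okS) (act (psum k) (PP s)).
Proof.
move=> ko; elim: s => [|p s IH]; first by rewrite PP_nil act1 ?psum_p0 // => _; exact: span0.
move=> /= /andP[hp hs]; rewrite PP_cons actM; last exact: additive_psum.
have /andP[/andP[l0 kl] le] := hp.
apply: spanD; last first.
  by rewrite -PP_seq1; apply: PPspanM (IH hs); apply: PPspan_PP; rewrite /= hp.
apply: PPspanM; last exact: PPspan_PP.
rewrite psum_P // msumP; apply: spanB.
  rewrite -(PP_seq1 (_, _)); apply: PPspan_PP; rewrite /= andbT /okS /validkl /=.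
  move: kl; rewrite !oddD /= ko; case: k ko {IH hs} => // k _.
  by case: (odd p.1); case: (odd p.2) => //= _; rewrite ltnS (leq_trans le) ?leq_addl.
by apply: spanZ; rewrite -PP_nil; exact: PPspan_PP.
Qed.

(** The factors are multiplied in one at a time: by [T1_mul], each contributes a product with
    [P k.-1 1] and a derivation that preserves the span. *)
Lemma PPspan_S_prod ks : all (fun k => (1 < k)%N && ~~ odd k) ks ->
  PPspan (all okS) (Zinv * prodf [seq S k | k <- ks]).
Proof.
elim: ks => [|k ks IH] /=.
  move=> _; have -> : (prodf [::] : pser) = Z * PP [::].
    by rewrite PP_nil mulr1; apply: funext => la; rewrite /prodf big_nil.
  by rewrite ZinvZ; exact: PPspan_PP.
case/andP=> /andP[k1 ke] /IH {}IH.
have -> : (prodf (S k :: [seq S k | k <- ks]) : pser) =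
    act (T k.-1 1) (Z * (Zinv * prodf [seq S k | k <- ks])).
  by rewrite ZZinv; apply: funext => la; rewrite /prodf big_cons.
have ko : odd k.-1 by case: k k1 ke => //= k _; rewrite negbK.
rewrite T1_mul ZinvZ; apply: spanD.
  rewrite -(PP_seq1 (_, _)); apply: PPspanM IH; apply: PPspan_PP.
  by rewrite /= andbT /okS /validkl /= addn1 /= ko; case: k k1 ko {ke} => [|[]].
by apply: span_act IH => _ [s hs ->]; exact: PPspan_act_psum.
Qed.

Lemma odot_list_eq (fs : seq pser) : odot_list fs = Z * \prod_(f <- fs) (Zinv * f) :> pser.
Proof.
elim: fs => [|f fs IH]; first by rewrite big_nil mulr1.
by rewrite big_cons -odotZ -IH ZZinv.
Qed.

Lemma inSymS_PPspan f : inSymS f -> PPspan (all okS) (Zinv * f).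
Proof.
apply: span_mull => _ [fs [hfs ->]]; rewrite odot_list_eq ZinvZ.
elim: fs hfs => [|g fs IH] hfs; first by rewrite big_nil -PP_nil; exact: PPspan_PP.
rewrite big_cons; apply: PPspanM; last by apply: IH => i hi; exact: (hfs i.+1).
apply: span_mull (hfs 0%N isT) => _ [ks [hks ->]]; exact: PPspan_S_prod.
Qed.

Lemma inS_act k f : odd k -> inS f -> inS (act (T k 1) f).
Proof.
move=> ko; apply: span_act => _ [ks [hks ->]]; apply: span_gen.
exists (k.+1 :: ks); split; first by rewrite /= hks ko; case: k ko.
by apply: funext => la; rewrite /act /prodf big_cons.
Qed.

Lemma inS_inSymS f : inS f -> inSymS f.
Proof.
move=> hf; apply: span_gen; exists [:: f]; split; first by case.
by rewrite odot_list_eq big_seq1 ZZinv.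
Qed.

Lemma inSymSM f g : inSymS f -> inSymS g -> inSymS (f * (Zinv * g)).
Proof.
move=> hf hg; apply: span_mulr hf => _ [fs [hfs ->]].
rewrite mulrA; apply: span_mull hg => _ [gs [hgs ->]].
apply: span_gen; exists (fs ++ gs); split.
  move=> i; rewrite size_cat nth_cat => h; case: (ltnP i (size fs)) => h'; first exact: hfs.
  by apply: hgs; rewrite ltn_subLR.
by rewrite !odot_list_eq big_cat -mulrA ZinvZ mulrA.
Qed.

Lemma inSymS_ZM f g : inSymS (Z * f) -> inSymS (Z * g) -> inSymS (Z * (f * g)).
Proof. by move=> /inSymSM h /h; rewrite ZinvZ mulrA. Qed.

Lemma inSymS_T k : odd k -> inSymS (Z * P k 1).
Proof.
move=> ko; apply: inS_inSymS; rewrite -T_eq; apply: span_gen.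
exists [:: k.+1]; split; first by rewrite /= ko; case: k ko.
by apply: funext => la; rewrite /prodf big_seq1.
Qed.

(** By the Leibniz rule it suffices to treat one factor [g] in [inS]. There [T1_mul] is solved for
    the derivation term, leaving the pointwise product of [T 1 1] and [g] minus their induced
    product. *)
Lemma inSymS_act_psum f : inSymS f -> inSymS (Z * act (psum 1) (Zinv * f)).
Proof.
apply: (@span_lin _ _ (fun f => Z * act (psum 1) (Zinv * f))) => [|x y|c x|].
- by rewrite mulr0 act0 mulr0.
- by rewrite mulrDr actD mulrDr.
- by rewrite -scalerAr actZ -scalerAr.
move=> _ [fs [hfs ->]]; rewrite odot_list_eq ZinvZ.
elim: fs hfs => [|g fs IH] hfs.
  by rewrite big_nil act1 ?psum_p0 // mulr0; exact: span0.
have hg : inS g := hfs 0%N isT.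
have hs i : (i < size fs)%N -> inS (nth Defs.one fs i) := hfs i.+1.
rewrite big_cons actM ?mulrDr; last exact: additive_psum.
apply: spanD; apply: inSymS_ZM.
- have -> : Z * act (psum 1) (Zinv * g) = act (T 1 1) g - Z * (P 1 1 * (Zinv * g)).
    by rewrite -{2}(ZZinv g) T1_mul mulrDr addrC addKr.
  apply: spanB; first by apply: inS_inSymS; exact: inS_act.
  by apply: inSymS_ZM; [exact: inSymS_T | rewrite ZZinv; exact: inS_inSymS].
- by apply: span_gen; exists fs; rewrite odot_list_eq.
- by rewrite ZZinv; exact: inS_inSymS.
- exact: IH.
Qed.

Lemma inSymS_one : inSymS Z.
Proof. by apply: span_gen; exists [::]. Qed.

(** Start from [P (k - l + 1) 1], whose first index is odd, and apply the derivation of [psum 1] a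
    total of [l - 1] times, discarding constants. *)
Lemma inSymS_P k l : okS (k, l) -> inSymS (Z * P k l).
Proof.
rewrite /okS /validkl /=; elim: l k => [//|[|l] IH] k /andP[kl le].
  by apply: inSymS_T; move: kl; rewrite addn1 /= negbK.
case: k kl le => // k kl le.
have /inSymS_act_psum : inSymS (Z * P k l.+1).
  apply: IH; move: kl; rewrite (le : (l < k)%N) andbT /= !oddD /=.
  by case: (odd k); case: (odd l).
rewrite ZinvZ psum_P // msumP add1n mulrBr -scalerAr mulr1 => h.
rewrite -[_ * _](subrK (Tconst k.+1 l.+2 *: Z)); apply: spanD h _.
by apply: spanZ; exact: inSymS_one.
Qed.

Lemma PPspan_inSymS f : PPspan (all okS) (Zinv * f) -> inSymS f.
Proof.
move=> h; rewrite -[f]ZZinv; apply: span_mull h => _ [s hs ->].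
elim: s hs => [_|p s IH /= /andP[hp hs]]; first by rewrite PP_nil mulr1; exact: inSymS_one.
by rewrite PP_cons; apply: inSymS_ZM (IH hs); apply: inSymS_P; case: p hp.
Qed.

Lemma is_Tbasis_inSymS : is_Tbasis inSymS (all okS).
Proof.
apply: is_Tbasis_PPspan => [p /andP[]//|f]; split; [exact: inSymS_PPspan | exact: PPspan_inSymS].
Qed.

(** * Multiplication by a general generator *)

Lemma rectP m la :
  reflect ((0 < r_ m la)%N /\ forall a, a != m -> r_ a la = 0%N) (rect m la).
Proof.
apply: (iffP andP) => [[r0 /eqP ->]|[r0 h]]; have m0 := r_gt0_pos r0.
  by split=> [|a ne]; rewrite r_mrect ?eqxx ?mul1n // (negbTE ne).
split=> //; apply/eqP/part_ext => a; rewrite r_mrect //.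
by case: eqVneq => [->|/h ->]; rewrite ?mul1n.
Qed.

(** With [q = u_m] this is [q/(1-q)^2 = x + x^2] for [x = q/(1-q)]. On coefficients, [r] is 1 plus
    the [r - 1] ways to split [u_m^r] into two positive powers. *)
Lemma Q2E m : Q 2 m = Q 1 m + Q 1 m * Q 1 m.
Proof.
apply: funext => la; rewrite pserD mulQ.
have [m0|m0] := posnP m; first by rewrite m0 /Q /rect !r_0 big_geq // addr0.
transitivity (Q 1 m la + \sum_(1 <= r < (r_ m la).+1) (rect m la && (r < r_ m la)%N)%:R).
  rewrite /Q; case: (boolP (rect m la)) => [/rectP[r0 h]|_] /=.
    rewrite expr0 expr1 -natr_sum -mulrS; congr (_%:R).
    rewrite big_nat_recr //= ltnn addn0 (eq_big_nat _ _ (F2 := fun=> 1%N)).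
      by rewrite sum_nat_const_nat muln1 subn1 prednK.
    by move=> r /andP[_ ->].
  by rewrite big1 ?addr0.
congr (_ + _); apply: eq_big_nat => r /andP[r1 rR]; rewrite expr0 mul1r /Q /=.
suff -> : rect m (pdiff la (mrect m r)) = rect m la && (r < r_ m la)%N by case: andb.
apply/rectP/andP => [[h1 h2]|[/rectP[h1 h2] h3]].
  move: h1; rewrite r_pdiff r_mrect // eqxx mul1n subn_gt0 => h1; split=> //.
  apply/rectP; split=> [|a ne]; first by lia.
  by have := h2 a ne; rewrite r_pdiff r_mrect // (negbTE ne) subn0.
split=> [|a ne]; first by rewrite r_pdiff r_mrect // eqxx mul1n subn_gt0.
by rewrite r_pdiff h2.
Qed.

(** As a rational function of [q = u_m] this is [(1+q)/(2(1-q))], which changes sign under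
    [q -> 1/q]; this is the source of the parity used below. *)
Definition hser m : pser := (2^-1 : rat)%:A + Q 1 m.

Definition ev m : {poly rat} -> pser := horner_alg (hser m).

HB.instance Definition _ m := GRing.LRMorphism.on (ev m).

Lemma evX m : ev m 'X = hser m.
Proof. exact: horner_algX. Qed.

Lemma evC m c : ev m c%:P = c%:A.
Proof. exact: horner_algC. Qed.

(* On polynomials in [h = 1/2 + q/(1-q)], [q = u_m], the derivation [q d/dq] acts through
   [h' = h^2 - 1/4]. *)
Definition hderiv (p : {poly rat}) : {poly rat} := p^`() * ('X^2 - (4^-1)%:P).

Lemma hderivD p q : hderiv (p + q) = hderiv p + hderiv q.
Proof. by rewrite /hderiv derivD mulrDl. Qed.

Lemma hderivM p q : hderiv (p * q) = hderiv p * q + p * hderiv q.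
Proof. by rewrite /hderiv derivM; ring. Qed.

(** Evaluation at 1/2 reads off the constant term in [u_m], which the Euler operator kills. *)
Lemma hderiv_half p : (hderiv p).[2^-1] = 0.
Proof.
rewrite /hderiv hornerM hornerD hornerN hornerXn hornerC.
by have -> : 2^-1 ^+ 2 - 4^-1 = 0 :> rat; [field | rewrite mulr0].
Qed.

(** For [x = Q 1 m], the derivative is [x + x^2 = (x + 1/2)^2 - 1/4]. *)
Lemma rdiff_hser m : rdiff m (hser m) = ev m ('X^2 - (4^-1)%:P).
Proof.
rewrite /rdiff actD actA // add0r [act _ _]rdiff_Q // eqxx Q2E.
rewrite rmorphB rmorphXn /= evX evC /hser.
have -> : (4^-1 : rat)%:A = (2^-1 : rat)%:A * (2^-1 : rat)%:A :> pser.
  by rewrite -scalerAl mul1r scalerA; congr (_ *: _); field.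
have e : (2^-1 : rat)%:A + (2^-1 : rat)%:A = 1 :> pser.
  by rewrite -scalerDl; have -> : 2^-1 + 2^-1 = 1 :> rat; [field | rewrite scale1r].
move: e; set x := _%:A; move: (Q 1 m) => q e.
have -> : (x + q) ^+ 2 - x * x = (x + x) * q + q * q by ring.
by rewrite e mul1r.
Qed.

Lemma rdiff_ev m p : rdiff m (ev m p) = ev m (hderiv p).
Proof.
elim/poly_ind: p => [|p c IH].
  by rewrite rmorph0 /rdiff act0 /hderiv deriv0 mul0r rmorph0.
have -> : hderiv (p * 'X + c%:P) = hderiv p * 'X + p * ('X^2 - (4^-1)%:P).
  by rewrite hderivD hderivM /hderiv derivX derivC mul1r mul0r addr0.
rewrite !rmorphD !rmorphM /= evX evC /rdiff actD actA // addr0 actM; last exact: additive_r.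
by rewrite -!/(rdiff m _) IH rdiff_hser rmorphM.
Qed.

(** Repeated differentiation of [h_m] produces the series [Q]; the subtracted constant is non-zero
    only for [j = 0]. *)
Lemma ev_iter_hderiv m j : ev m (iter j hderiv 'X - ((iter j hderiv 'X).[2^-1])%:P) = Q j.+1 m.
Proof.
rewrite rmorphB /= evC; case: j => [|j]; first by rewrite evX hornerX /hser addrC addKr.
rewrite [(iter _ _ _).[_]]hderiv_half scale0r subr0; elim: j => [|j IH] /=.
  rewrite -rdiff_ev evX /hser /rdiff actD actA // add0r.
  by rewrite [act _ _]rdiff_Q // eqxx.
by rewrite -rdiff_ev IH rdiff_Q // eqxx.
Qed.

(** The factor [X - 1/2] of [p] evaluates to [Q 1 m]. *)
Lemma vanishing_off_ev m p : p.[2^-1] = 0 -> vanishing_off m (ev m p).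
Proof.
move=> /rootP/factor_theorem[q ->]; rewrite rmorphM rmorphB /= evX evC /hser addrC addKr.
by rewrite mulrC; apply/vanishing_offM/vanishing_off_Q.
Qed.

Definition has_parity (e : nat) (p : {poly rat}) := forall i, odd (i + e) -> p`_i = 0.

Lemma has_parity_cong e e' p : odd e = odd e' -> has_parity e p -> has_parity e' p.
Proof. by move=> ee hp i h; apply: hp; move: h; rewrite !oddD ee. Qed.

Lemma has_parityD e p q : has_parity e p -> has_parity e q -> has_parity e (p + q).
Proof. by move=> hp hq i h; rewrite coefD hp ?hq ?addr0. Qed.

Lemma has_parityZ e c p : has_parity e p -> has_parity e (c *: p).
Proof. by move=> hp i h; rewrite coefZ hp ?mulr0. Qed.

Lemma has_parityM e e' p q : has_parity e p -> has_parity e' q -> has_parity (e + e') (p * q).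
Proof.
move=> hp hq i h; rewrite coefM big1 // => j _; have jn : (j <= i)%N by rewrite -ltnS.
have [ho|ho] := boolP (odd (j + e)); first by rewrite hp ?mul0r.
rewrite hq ?mulr0 //; move: h ho; rewrite !oddD oddB //.
by case: (odd i); case: (odd j); case: (odd e); case: (odd e').
Qed.

Lemma has_parityX : has_parity 1 'X.
Proof. by move=> i; rewrite coefX addn1; case: eqP => [->|]. Qed.

Lemma has_parity1 : has_parity 0 1.
Proof. by move=> i; rewrite coef1 addn0; case: eqP => [->|]. Qed.

Lemma has_parity_hderiv e p : has_parity e p -> has_parity e.+1 (hderiv p).
Proof.
move=> hp; rewrite -[e.+1]addn0; apply: has_parityM => i.
  by rewrite addnS -addSn coef_deriv => /hp ->; rewrite mul0rn.
rewrite addn0 coefB coefXn coefC; by case: eqP => [->|] //; case: eqP => [->|] //; rewrite subr0.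
Qed.

Lemma has_parity_iter j : has_parity j.+1 (iter j hderiv 'X).
Proof. by elim: j => [|j IH]; [exact: has_parityX | exact: has_parity_hderiv]. Qed.

(** Each application of [hderiv] raises the degree by one and multiplies the leading coefficient by
    the old degree. *)
Lemma size_iter_hderiv j : (size (iter j hderiv 'X) <= j.+2)%N /\ (iter j hderiv 'X)`_j.+1 != 0.
Proof.
elim: j => [|j [IH1 IH2]]; first by rewrite size_polyX coefX.
have coefh (p : {poly rat}) i : (hderiv p)`_i.+2 = p`_i.+1 *+ i.+1 - 4^-1 * (p`_i.+3 *+ i.+3).
  rewrite /hderiv mulrBr coefB coefMXn /= coefMC !coef_deriv subSS subSS subn0.
  by rewrite mulrC.
split.
  apply/leq_sizeP => -[|[|i]] // hi; rewrite iterS coefh.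
  by rewrite !(leq_sizeP _ _ IH1) ?mul0rn ?mulr0 ?subr0 //; lia.
rewrite iterS coefh (leq_sizeP _ _ IH1 j.+3) // mul0rn mulr0 subr0 mulrn_eq0.
by rewrite negb_or.
Qed.

(** The iterates of [hderiv] on [X] have every positive degree once, and each has a parity.
    Subtracting a multiple of the iterate of the same degree removes the leading term of [p] without
    disturbing its parity. *)
Lemma parity_ind (V : {poly rat} -> Prop) e :
    (forall p q, V p -> V q -> V (p + q)) -> (forall c p, V p -> V (c *: p)) ->
    V 1 -> (forall j, odd j.+1 = odd e -> V (iter j hderiv 'X)) ->
  forall p, has_parity e p -> V p.
Proof.
move=> VD VZ V1 Vj p; have [n] := ubnP (size p).
elim: n p => // n IH p; rewrite ltnS => sp hp.
have [sp1|] := leqP (size p) 1.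
  by rewrite (size1_polyC sp1) -alg_polyC; exact: VZ.
case sz : (size p) => [|[|j]] // _; have pj : p`_j.+1 != 0.
  by rewrite -[j.+1]/(j.+2.-1) -sz -lead_coefE lead_coef_eq0 -size_poly_eq0 sz.
have je : odd j.+1 = odd e.
  by apply/eqP; apply: contraNT pj => ne; rewrite hp //; rewrite oddD; case: odd (odd e) ne => -[].
have [b1 b2] := size_iter_hderiv j; set b := iter j hderiv 'X in b1 b2.
rewrite -[p](subrK ((p`_j.+1 / b`_j.+1) *: b)); apply: VD; last exact/VZ/Vj.
apply: IH; last first.
  apply: has_parityD => //; rewrite -scaleNr; apply: has_parityZ.
  exact: has_parity_cong je (@has_parity_iter j).
apply: leq_ltn_trans (_ : j.+1 < n)%N; last by rewrite -sz.
apply/leq_sizeP => i; rewrite leq_eqVlt coefB coefZ => /orP[/eqP <-|hi].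
  by rewrite divfK // subrr.
have szp : (size p <= j.+2)%N by rewrite sz.
by rewrite (leq_sizeP _ _ szp i hi) (leq_sizeP _ _ b1 i hi) mulr0 subrr.
Qed.

(** * Products of bounded length and families indexed by a part size *)

Definition okn n s := all validkl s && (size s <= n)%N.

Lemma PPspan_okn1 n : PPspan (okn n) 1.
Proof. by rewrite -PP_nil; apply: PPspan_PP. Qed.

Lemma PPspan_okn n n' f : (n <= n')%N -> PPspan (okn n) f -> PPspan (okn n') f.
Proof.
by move=> le; apply: PPspanS => s /andP[s1 s2]; rewrite unfold_in /okn s1 (leq_trans s2 le).
Qed.

Lemma PPspan_okn_mul n n' f g : PPspan (okn n) f -> PPspan (okn n') g ->
  PPspan (okn (n + n')) (f * g).
Proof.
move=> hf hg; apply: span_mulr hf => _ [s /andP[s1 s2] ->]; apply: span_mull hg => _ [t /andP[t1 t2] ->].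
by rewrite -PP_cat; apply: PPspan_PP; rewrite /okn all_cat s1 t1 size_cat leq_add.
Qed.

(** By [parity_ind] it suffices to take [p] constant, giving 0, or an iterate of index [j], giving
    [P k j.+1] minus its constant; the parity condition makes the latter a valid index. *)
Lemma PPspan_msum_ev k p : has_parity k p ->
  PPspan (okn 1) (msum (fun m => m%:R ^+ k *: ev m (p - (p.[2^-1])%:P))).
Proof.
pose V p := PPspan (okn 1) (msum (fun m => m%:R ^+ k *: ev m (p - (p.[2^-1])%:P))).
apply: (@parity_ind V) => [p1 p2|c p1||j jk]; rewrite /V.
- move=> h1 h2; have := spanD h1 h2; rewrite -msumD; congr (PPspan _ (msum _)); apply: funext => m.
  by rewrite -scalerDr -rmorphD hornerD polyCD opprD addrACA.
- move=> h1; have := spanZ c h1; rewrite -msumZ; congr (PPspan _ (msum _)); apply: funext => m.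
  have -> : c *: p1 - ((c *: p1).[2^-1])%:P = c *: (p1 - (p1.[2^-1])%:P).
    by rewrite scalerBr hornerZ polyCM mul_polyC.
  by rewrite -[in RHS]mul_polyC rmorphM /= evC mulr_algl !scalerA mulrC.
- rewrite hornerC subrr (_ : (fun m => _) = fun=> 0) ?msum0; first exact: span0.
  by apply: funext => m; rewrite rmorph0 scaler0.
- under [fun m => _]funext do rewrite ev_iter_hderiv.
  rewrite msumP; apply: spanB; last by apply: spanZ; exact: PPspan_okn1.
  rewrite -(PP_seq1 (_, _)); apply: PPspan_PP.
  by rewrite /okn /= !andbT /validkl /= oddD -jk addbb.
Qed.

(* Families of series indexed by a part size [m], spanned by
   [m^a g(h_m) P_(k_1,l_1) ... P_(k_r,l_r)] with [r <= n], [g(1/2) = 0] and [g] of the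
   parity of [e + a]; such a family, weighted by [m^k] with [k = e] mod 2, sums up to
   a combination of products of at most [n + 1] series [P]. *)
Inductive mfamily (n e : nat) : (nat -> pser) -> Prop :=
| mfamily0 : mfamily n e (fun=> 0)
| mfamilyS a p s y : has_parity (e + a) p -> p.[2^-1] = 0 -> okn n s -> mfamily n e y ->
    mfamily n e (fun m => m%:R ^+ a *: (ev m p * PP s) + y m).

Lemma mfamily_eq n e y y' : y =1 y' -> mfamily n e y -> mfamily n e y'.
Proof. by move=> /funext ->. Qed.

Lemma mfamily_gen n e a p s : has_parity (e + a) p -> p.[2^-1] = 0 -> okn n s ->
  mfamily n e (fun m => m%:R ^+ a *: (ev m p * PP s)).
Proof.
move=> h1 h2 h3; apply: mfamily_eq (mfamilyS h1 h2 h3 (mfamily0 n e)) => m.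
by rewrite addr0.
Qed.

Lemma mfamilyD n e y y' : mfamily n e y -> mfamily n e y' -> mfamily n e (fun m => y m + y' m).
Proof.
elim=> [|a p s z h1 h2 h3 _ IH] hy'; first by apply: mfamily_eq hy' => m; rewrite add0r.
by apply: mfamily_eq (mfamilyS h1 h2 h3 (IH hy')) => m; rewrite addrA.
Qed.

Lemma mfamily_mul n n' e e' a p s y : has_parity (e' + a) p -> okn n' s ->
  mfamily n e y -> mfamily (n + n') (e + e') (fun m => m%:R ^+ a *: (ev m p * PP s) * y m).
Proof.
move=> hp /andP[s1 s2]; elim=> [|b q t z h1 h2 /andP[t1 t2] _ IH].
  by apply: mfamily_eq (mfamily0 _ _) => m; rewrite mulr0.
have := @mfamilyS (n + n') (e + e') (a + b) (p * q) (s ++ t) _ _ _ _ IH.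
move=> H; apply: mfamily_eq (H _ _ _) => [m|||].
- rewrite mulrDr; congr (_ + _); rewrite rmorphM PP_cat exprD -scalerA.
  by rewrite -scalerAl -[in RHS]scalerAr; congr (_ *: (_ *: _)); rewrite mulrACA.
- have := has_parityM hp h1; apply: has_parity_cong; rewrite !oddD.
  by case: (odd e); case: (odd e'); case: (odd a); case: (odd b).
- by rewrite hornerM h2 mulr0.
- by rewrite /okn all_cat s1 t1 size_cat addnC leq_add.
Qed.

(** Differentiating a factor [P k l] replaces it by [m^k] times the [l]-th derivative of [h_m], so
    every term of the Leibniz rule has one series [P] fewer. *)
Lemma mfamily_rdiff_PP n s : okn n.+1 s -> mfamily n 1 (fun m => rdiff m (PP s)).
Proof.
elim: s n => [|p s IH] n.
  move=> _; apply: mfamily_eq (mfamily0 _ _) => m.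
  by rewrite PP_nil /rdiff act1.
rewrite /okn /= ltnS => /andP[/andP[/andP[l0 kl] hs] le].
apply: (mfamily_eq (y := fun m => rdiff m (P p.1 p.2) * PP s + PP [:: p] * rdiff m (PP s))).
  by move=> m; rewrite PP_seq1 PP_cons /rdiff actM //; exact: additive_r.
apply: mfamilyD.
  have := @mfamily_gen n 1 p.1 (iter p.2 hderiv 'X) s; move=> H; apply: mfamily_eq (H _ _ _).
  - move=> m; rewrite rdiff_P // -scalerAl; congr (_ *: (_ * _)).
    by case: p.2 l0 => // l _; rewrite -ev_iter_hderiv /= hderiv_half subr0.
  - apply: has_parity_cong (@has_parity_iter _); move: kl; rewrite oddD /=.
    by case: (odd p.1); case: (odd p.2).
  - by case: p.2 l0 => // l _; rewrite /= hderiv_half.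
  - by rewrite /okn hs.
(* For [n = 0] there is no room for the undifferentiated factor [p], but then [s] is empty and its
   derivative is 0. *)
case: n le => [|n] le.
  have -> : s = [::] by case: s le {IH hs}.
  apply: mfamily_eq (mfamily0 _ _) => m; by rewrite PP_nil /rdiff act1 // mulr0.
have hs' : okn n.+1 s by rewrite /okn hs.
have := @mfamily_mul n 1 1 0 0 1 [:: p] _ has_parity1 _ (IH _ hs').
rewrite addn1 addn0; move=> H; apply: mfamily_eq (H _) => [m|].
  by rewrite expr0 scale1r rmorph1 mul1r.
by rewrite /okn /= andbT /validkl l0 kl.
Qed.

Lemma mfamily_ev n e e' p y : has_parity e' p -> mfamily n e y ->
  mfamily n (e + e') (fun m => ev m p * y m).
Proof.
move=> hp hy; have := @mfamily_mul n 0 e e' 0 p [::] y; rewrite !addn0 => /(_ hp isT hy).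
by apply: mfamily_eq => m; rewrite expr0 scale1r PP_nil mulr1.
Qed.

Lemma mfamily_rdiff n e y : mfamily n e y -> mfamily n e.+1 (fun m => rdiff m (y m)).
Proof.
elim=> [|a p s z h1 h2 h3 _ IH].
  by apply: mfamily_eq (mfamily0 _ _) => m; rewrite /rdiff act0.
apply: (mfamily_eq (y := fun m => (m%:R ^+ a *: (ev m (hderiv p) * PP s) +
    m%:R ^+ a *: (ev m p * PP [::]) * rdiff m (PP s)) + rdiff m (z m))).
  move=> m; rewrite /rdiff actD; congr (_ + _); rewrite actZ actM; last exact: additive_r.
  by rewrite PP_nil mulr1 -scalerAl -scalerDr -/(rdiff m (ev m p)) rdiff_ev.
apply: mfamilyD IH; apply: mfamilyD.
  by apply: mfamily_gen; rewrite ?hderiv_half //; exact: has_parity_hderiv.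
have h3' : okn n.+1 s by move: h3; rewrite /okn => /andP[-> /leqW].
by have := mfamily_mul h1 (isT : okn 0 [::]) (mfamily_rdiff_PP h3'); rewrite addn0 add1n.
Qed.

(** * Multiplication by powers of [r_m + 1/2] *)

Definition shiftop m w : pser := rdiff m w + hser m * w.

Definition shiftpoly l : {poly rat} := iter l (fun p => hderiv p + 'X * p) 1.

Lemma shiftpoly_parity l : has_parity l (shiftpoly l).
Proof.
elim: l => [|l IH]; first exact: has_parity1.
by apply: has_parityD; [exact: has_parity_hderiv | exact: has_parityM has_parityX IH].
Qed.

Lemma shiftpoly_half l : (shiftpoly l).[2^-1] = 2^-1 ^+ l.
Proof.
elim: l => [|l IH]; first by rewrite hornerC.
by rewrite /= hornerD hderiv_half add0r hornerM hornerX IH exprS.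
Qed.

Lemma iter_shiftop1 m l : iter l (shiftop m) 1 = ev m (shiftpoly l).
Proof.
elim: l => [|l IH] /=; first by rewrite rmorph1.
by rewrite IH rmorphD /= -rdiff_ev rmorphM /= evX.
Qed.

(** The difference collects the terms in which some derivative hits [PP s]. Passing from [l] to
    [l.+1] applies [shiftop] to the old difference and adds [ev m (shiftpoly l)] times the
    derivative of [PP s]. *)
Lemma mfamily_shiftop n s l : okn n.+1 s ->
  mfamily n l (fun m => iter l (shiftop m) (PP s) - ev m (shiftpoly l) * PP s).
Proof.
move=> hs; elim: l => [|l IH].
  by apply: mfamily_eq (mfamily0 _ _) => m; rewrite /= rmorph1 mul1r subrr.
have h1 := mfamily_rdiff IH.
have h2 := mfamily_ev has_parityX IH; rewrite addn1 in h2.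
have h3 := mfamily_ev (@shiftpoly_parity l) (mfamily_rdiff_PP hs); rewrite add1n in h3.
apply: mfamily_eq (mfamilyD (mfamilyD h1 h2) h3) => m /=.
rewrite rmorphD /= -rdiff_ev rmorphM /= evX /shiftop /rdiff actB.
by rewrite actM; [ring | exact: additive_r].
Qed.

(** The product [PP s] does not depend on [m] and leaves the sum; what remains is a sum as in
    [PPspan_msum_ev] and costs one more series [P]. *)
Lemma PPspan_msum_mfamily n e k y : odd k = odd e -> mfamily n e y ->
  PPspan (okn n.+1) (msum (fun m => m%:R ^+ k *: y m)).
Proof.
move=> ke; elim=> [|a p s z h1 h2 h3 _ IH].
  rewrite (_ : (fun m => _) = fun=> 0) ?msum0; first exact: span0.
  by apply: funext => m; rewrite scaler0.
have -> : (fun m => m%:R ^+ k *: (m%:R ^+ a *: (ev m p * PP s) + z m)) =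
    (fun m => (m%:R ^+ (k + a) *: ev m p) * PP s + m%:R ^+ k *: z m).
  by apply: funext => m; rewrite scalerDr scalerA -exprD scalerAl.
rewrite msumD; apply: spanD IH; rewrite -msumMl; last first.
  by move=> m; apply/vanishing_offZ/vanishing_off_ev.
rewrite -add1n; apply: PPspan_okn_mul (PPspan_PP h3).
have := @PPspan_msum_ev (k + a) p; rewrite h2 subr0; apply.
by apply: has_parity_cong h1; rewrite !oddD ke.
Qed.

(** By the Leibniz rule and [D_m Z = Z * Q 1 m], moving [r_m + 1/2] past [Z] adds the series [h_m]
    to the derivation [D_m]. *)
Lemma act_shift m l w :
  act (fun la => ((r_ m la)%:R + 2^-1) ^+ l) (Z * w) = Z * iter l (shiftop m) w.
Proof.
have rZ : rdiff m Z = Z * Q 1 m.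
  apply: funext => la; rewrite mulrC mulQZ /rdiff /act /faulhaber mulr1.
  by under eq_bigr do rewrite expr0; rewrite sumr_const_nat subSS subn0.
elim: l => [|l IH]; first by apply: funext => la; rewrite /act expr0 mul1r.
rewrite /= {1}/shiftop; set v := iter _ _ _ in IH *.
have -> : Z * (rdiff m v + hser m * v) = rdiff m (Z * v) + 2^-1 *: (Z * v).
  rewrite [rdiff m (Z * v)]actM; last exact: additive_r.
  rewrite -/(rdiff m _) -/(rdiff m _) rZ /hser mulrDl -(scalerAl _ 1) mul1r !mulrDr -scalerAr.
  by ring.
by rewrite -IH; apply: funext => la; rewrite pserD pserZ /rdiff /act exprS; ring.
Qed.

(** Subtracting the value at multiplicity 0 leaves only the part sizes that occur in [la]. *)
Definition shiftsum k l la : rat :=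
  \sum_(1 <= m < (sumn (pval la)).+1) m%:R ^+ k * (((r_ m la)%:R + 2^-1) ^+ l - 2^-1 ^+ l).

Lemma act_shiftsum k l w : Zinv * act (shiftsum k l) (Z * w) =
  msum (fun m => m%:R ^+ k *: (iter l (shiftop m) w - 2^-1 ^+ l *: w)).
Proof.
have -> : act (shiftsum k l) (Z * w) = msum (fun m => m%:R ^+ k *:
    (act (fun la => ((r_ m la)%:R + 2^-1) ^+ l) (Z * w) - 2^-1 ^+ l *: (Z * w))).
  apply: funext => la; rewrite /act /shiftsum mulr_suml; apply: eq_bigr => m _.
  by rewrite pserZ pserD pserN pserZ; ring.
rewrite mulrC msumMl => [|m la rm]; last first.
  by rewrite pserZ pserD pserN pserZ /act rm add0r subrr mulr0.
congr msum; apply: funext => m; rewrite -scalerAl mulrC; congr (_ *: _).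
by rewrite act_shift scalerAr -mulrBr ZinvZ.
Qed.

(** After division by [Z], multiplying pointwise by [phi] is multiplying by [phi / Z] up to products
    that are no longer. The condition is linear in [phi], so it passes from shifted powers to
    Faulhaber sums. *)
Definition nearly_mult (phi : pser) := forall s, all validkl s ->
  PPspan (okn (size s)) (Zinv * act phi (Z * PP s) - Zinv * phi * PP s).

Lemma nearly_multD phi psi : nearly_mult phi -> nearly_mult psi -> nearly_mult (phi + psi).
Proof.
move=> h1 h2 s hs; have := spanD (h1 s hs) (h2 s hs); congr PPspan.
have -> f : act (phi + psi) f = act phi f + act psi f.
  by apply: funext => la; rewrite /act !pserD /act mulrDl.
by rewrite !mulrDr mulrDl; ring.
Qed.

Lemma nearly_multZ c phi : nearly_mult phi -> nearly_mult (c *: phi).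
Proof.
move=> h s hs; have := spanZ c (h s hs); congr PPspan.
have -> f : act (c *: phi) f = c *: act phi f.
  by apply: funext => la; rewrite /act !pserZ mulrA.
by rewrite scalerBr -!scalerAr -scalerAl.
Qed.

Lemma nearly_mult_const c : nearly_mult (c *: Z).
Proof.
move=> s _; have -> : act (c *: Z) (Z * PP s) = c *: (Z * PP s).
  by apply: funext => la; rewrite /act !pserZ mulr1.
by rewrite -!scalerAr -scalerAl ZinvZ [Zinv * _]mulrC mulZzinv mul1r subrr; exact: span0.
Qed.

Lemma nearly_mult_shiftsum k l : ~~ odd (k + l) -> nearly_mult (shiftsum k l).
Proof.
move=> kl s hs.
have kle : odd k = odd l by move: kl; rewrite oddD; case: (odd k); case: (odd l).
(* The case [w = 1] of [act_shiftsum] computes [shiftsum k l] divided by [Z]. *)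
have e0 : Zinv * (shiftsum k l : pser) =
    msum (fun m => m%:R ^+ k *: ev m (shiftpoly l - ((shiftpoly l).[2^-1])%:P)).
  have := act_shiftsum k l 1; rewrite mulr1.
  have -> : act (shiftsum k l) Z = shiftsum k l by apply: funext => la; rewrite /act mulr1.
  move=> ->; congr msum; apply: funext => m; congr (_ *: _).
  by rewrite rmorphB /= evC shiftpoly_half iter_shiftop1.
rewrite e0 act_shiftsum msumMl; last first.
  by move=> m; apply/vanishing_offZ/vanishing_off_ev; rewrite hornerD hornerN hornerC subrr.
rewrite -[- msum _]scaleN1r -msumZ -msumD.
have -> : (fun m => m%:R ^+ k *: (iter l (shiftop m) (PP s) - 2^-1 ^+ l *: PP s) +
    -1 *: (m%:R ^+ k *: ev m (shiftpoly l - ((shiftpoly l).[2^-1])%:P) * PP s)) =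
    (fun m => m%:R ^+ k *: (iter l (shiftop m) (PP s) - ev m (shiftpoly l) * PP s)).
  apply: funext => m; rewrite scaleN1r -scalerAl -scalerBr; congr (_ *: _).
  by rewrite rmorphB /= evC shiftpoly_half mulrBl -scalerAl mul1r; ring.
(* For an empty product the difference is exactly 0; otherwise its length is a successor, as
   [mfamily_shiftop] requires. *)
case: s hs => [|p s] hs.
  rewrite (_ : (fun m => _) = fun=> 0) ?msum0; first exact: span0.
  by apply: funext => m; rewrite PP_nil mulr1 iter_shiftop1 subrr scaler0.
apply: PPspan_msum_mfamily kle _; apply: mfamily_shiftop.
by rewrite /okn hs /=.
Qed.

Definition Fsum k l la : rat :=
  \sum_(1 <= m < (sumn (pval la)).+1) m%:R ^+ k * faulhaber l (r_ m la).

Lemma faulhaberS l r : faulhaber l r.+1 = faulhaber l r + r.+1%:R ^+ l.-1.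
Proof. by rewrite /faulhaber big_nat_recr. Qed.

(* Telescoping [(i + 1/2)^l - (i - 1/2)^l] over [1 <= i <= r]. *)
Lemma shift_pow_faulhaber l r : (0 < l)%N ->
  (r%:R + 2^-1) ^+ l - 2^-1 ^+ l =
  \sum_(i < l.+1 | odd i) ('C(l, i)%:R * 2 * 2^-1 ^+ i) * faulhaber (l - i).+1 r :> rat.
Proof.
move=> l0; elim: r => [|r IH].
  by rewrite add0r subrr big1 // => i _; rewrite /faulhaber big_geq ?mulr0.
under eq_bigr do rewrite faulhaberS mulrDr.
rewrite big_split -IH /=; set x : rat := r.+1%:R.
have -> : r%:R + 2^-1 = x - 2^-1 :> rat by rewrite /x -natr1; field.
suff -> : \sum_(i < l.+1 | odd i) 'C(l, i)%:R * 2 * 2^-1 ^+ i * x ^+ (l - i) =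
   (x + 2^-1) ^+ l - (x - 2^-1) ^+ l by ring.
rewrite exprDn exprBn -sumrB big_mkcond; apply: eq_bigr => i _.
rewrite -mulrnBl -[RHS]mulr_natl -signr_odd; case: (odd i); rewrite ?expr0 ?expr1; ring.
Qed.

Lemma shiftsumE k l : (0 < l)%N -> (shiftsum k l : pser) =
  \sum_(i < l.+1 | odd i) ('C(l, i)%:R * 2 * 2^-1 ^+ i) *: (Fsum k (l - i).+1 : pser).
Proof.
move=> l0; apply: funext => la; rewrite pser_sum /shiftsum.
under eq_bigr do rewrite shift_pow_faulhaber // mulr_sumr.
rewrite exchange_big; apply: eq_bigr => i _ /=; rewrite pserZ /Fsum mulr_sumr.
by apply: eq_bigr => m _; rewrite mulrCA.
Qed.

Lemma nearly_mult0 : nearly_mult 0.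
Proof. by rewrite -(scale0r Z); exact: nearly_mult_const. Qed.

(** The expansion [shiftsumE] is triangular: the term [i = 1] is [l] times [Fsum k l], and the odd
    [i >= 3] give Faulhaber sums of smaller index and the same parity. *)
Lemma nearly_mult_Fsum k l : (0 < l)%N -> ~~ odd (k + l) -> nearly_mult (Fsum k l).
Proof.
have [n] := ubnP l; elim: n l => // n IH l; rewrite ltnS => ln l0 kl.
have := nearly_mult_shiftsum kl; rewrite shiftsumE //.
have l1 : (1 < l.+1)%N by [].
rewrite (bigD1 (Ordinal l1)) //= bin1 subn1 expr1 prednK //; set y := \sum_(_ < _ | _) _.
have hy : nearly_mult y.
  rewrite /y; elim/big_ind: _ => [||i /andP[oi i1]]; [exact: nearly_mult0 | exact: nearly_multD |].
  apply: nearly_multZ; have il : (i <= l)%N by rewrite -ltnS.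
  have i2 : (1 < i)%N.
    by case: i oi i1 {il} => [[|[|i]] hi].
  apply: IH => //; first by apply: leq_trans ln; move: il i2; clear; case: i => i /= _; lia.
  by move: kl; rewrite addnS /= !oddD oddB // oi; case: (odd k); case: (odd l).
have c0 : l%:R * 2 / 2 = l%:R :> rat by field.
rewrite c0 => h; have l0' : l%:R != 0 :> rat by rewrite pnatr_eq0 -lt0n.
have -> : (Fsum k l : pser) = l%:R^-1 *: (l%:R *: (Fsum k l : pser) + y + (-1) *: y).
  by rewrite scaleN1r addrK scalerA mulVf // scale1r.
by apply: nearly_multZ; apply: nearly_multD h _; exact: nearly_multZ.
Qed.

Lemma nearly_mult_T k l : validkl (k, l) -> nearly_mult (T k l).
Proof.
move=> /andP[l0 kl]; have -> : (T k l : pser) = Tconst k l *: Z + Fsum k l.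
  by apply: funext => la; rewrite pserD pserZ mulr1.
by apply: nearly_multD; [exact: nearly_mult_const | exact: nearly_mult_Fsum].
Qed.

Lemma act_T k l s : validkl (k, l) -> all validkl s ->
  PPspan (okn (size s)) (Zinv * act (T k l) (Z * PP s) - P k l * PP s).
Proof. by move=> kl hs; have := nearly_mult_T kl hs; rewrite T_eq ZinvZ. Qed.

(** * The algebra generated by all [T k l] *)

Lemma PPspan_okn_all n f : PPspan (okn n) f -> PPspan (all validkl) f.
Proof. by apply: PPspanS => s /andP[]. Qed.

Lemma inT_PPspan f : inT f -> PPspan (all validkl) (Zinv * f).
Proof.
apply: span_mull => _ [s [hs ->]]; elim: s hs => [_|p s IH /= /andP[hp hs]].
  have -> : (prodf [::] : pser) = Z * PP [::].
    by rewrite PP_nil mulr1; apply: funext => la; rewrite /prodf big_nil.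
  by rewrite ZinvZ; exact: PPspan_PP.
have -> : (prodf (T p.1 p.2 :: [seq T p.1 p.2 | p <- s]) : pser) =
    act (T p.1 p.2) (Z * (Zinv * prodf [seq T p.1 p.2 | p <- s])).
  by rewrite ZZinv; apply: funext => la; rewrite /prodf big_cons.
have := IH hs; apply: (@span_lin _ _ (fun x => Zinv * act (T p.1 p.2) (Z * x))).
- by rewrite mulr0 act0 mulr0.
- by move=> x y; rewrite mulrDr actD mulrDr.
- by move=> c x; rewrite -scalerAr actZ -scalerAr.
move=> _ [t ht ->]; rewrite -[_ * _](subrK (P p.1 p.2 * PP t)); apply: spanD.
  by apply: PPspan_okn_all; apply: act_T => //; case: p hp.
by rewrite -PP_cons; apply: PPspan_PP; rewrite /= hp.
Qed.

Lemma inT_act_T k l f : validkl (k, l) -> inT f -> inT (act (T k l) f).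
Proof.
move=> kl; apply: span_act => _ [s [hs ->]]; apply: span_gen.
exists ((k, l) :: s); split; first by rewrite /= kl.
by apply: funext => la; rewrite /act /prodf big_cons.
Qed.

Lemma inT_one : inT Z.
Proof.
apply: span_gen; exists [::]; split=> //.
by apply: funext => la; rewrite /prodf big_nil.
Qed.

(** [Z * PP (p :: s)] is the pointwise product of [T p.1 p.2] with [Z * PP s], minus an error made
    of products with at most [size s] factors, which the induction covers. *)
Lemma inT_PP n s : okn n s -> inT (Z * PP s).
Proof.
elim: n s => [|n IH] [|p s]; try by rewrite PP_nil mulr1 => _; exact: inT_one.
  by rewrite /okn /= ltn0 andbF.
rewrite /okn /= ltnS => /andP[/andP[hp hs] sn].
have hs' : inT (Z * PP s) by apply: IH; rewrite /okn hs.
have hp' : validkl (p.1, p.2) by case: p hp.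
have e : Z * PP (p :: s) = act (T p.1 p.2) (Z * PP s) -
    Z * (Zinv * act (T p.1 p.2) (Z * PP s) - P p.1 p.2 * PP s).
  by rewrite PP_cons mulrBr ZZinv opprB addrCA subrr addr0.
rewrite e; apply: spanB; first exact: inT_act_T.
apply: span_mull (PPspan_okn sn (act_T hp' hs)) => _ [t ht ->]; exact: IH.
Qed.

Lemma is_Tbasis_inT : is_Tbasis inT (all validkl).
Proof.
apply: is_Tbasis_PPspan => // f; split; first exact: inT_PPspan.
move=> h; rewrite -[f]ZZinv; apply: span_mull h => _ [s hs ->].
by apply: (@inT_PP (size s)); rewrite /okn hs /=.
Qed.

Theorem theorem4p3p1 :
  is_Tbasis inT (all validkl) /\
  is_Tbasis inSymS (all (fun p => validkl p && (p.2 <= p.1)%N)).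
Proof. by split; [exact: is_Tbasis_inT | exact: is_Tbasis_inSymS]. Qed.
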